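(* Let $\Lambda=\begin{pmatrix} A & N \\ M & B \end{pmatrix}$ be a Morita ring which is an Artin algebra, with $M\otimes_A N=0=N\otimes_B M$. Assume that ${}_BM$, ${}_AN$, $M_A$ and $N_B$ are projective modules. Let $\begin{pmatrix} X \\ Y \end{pmatrix}_{f,g}$ be a left $\Lambda$-module. Then $\begin{pmatrix} X \\ Y \end{pmatrix}_{f,g}$ is a semi-Gorenstein-projective $\Lambda$-module if and only if all of the following conditions are satisfied: (1) $\operatorname{Hom}_A(g,A):\operatorname{Hom}_A(X,A)\to\operatorname{Hom}_A(N\otimes_BY,A)$ is an epimorphism; (2) $\operatorname{Ext}^i_A(g,A):\operatorname{Ext}^i_A(X,A)\to\operatorname{Ext}^i_A(N\otimes_BY,A)$ is an isomorphism for every $i\ge1$; (3) $\operatorname{Hom}_B(f,B):\operatorname{Hom}_B(Y,B)\to\operatorname{Hom}_B(M\otimes_AX,B)$ is an epimorphism; (4) $\operatorname{Ext}^i_B(f,B):\operatorname{Ext}^i_B(Y,B)\to\operatorname{Ext}^i_B(M\otimes_AX,B)$ is an isomorphism for every $i\ge1$.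
   Context: All modules are finitely generated. $A$ and $B$ are Artin $R$-algebras over a commutative artinian ring $R$; ${}_BM_A$ and ${}_AN_B$ are bimodules, finitely generated over $R$, on which $R$ acts centrally. A Morita ring $\Lambda$ is the set of matrices $\begin{pmatrix} a & n \\ m & b \end{pmatrix}$ with multiplication defined using bimodule maps $\phi:M\otimes_AN\to B$ and $\psi:N\otimes_BM\to A$; since here $M\otimes_AN=0=N\otimes_BM$, $\phi=0=\psi$ and $$\begin{pmatrix} a & n \\ m & b \end{pmatrix}\begin{pmatrix} a' & n' \\ m' & b' \end{pmatrix}=\begin{pmatrix} aa' & an'+nb' \\ ma'+bm' & bb' \end{pmatrix}.$$ A left $\Lambda$-module is identified with a quadruple $\begin{pmatrix} X \\ Y \end{pmatrix}_{f,g}$, where $X$ is a left $A$-module, $Y$ a left $B$-module, $f\in\operatorname{Hom}_B(M\otimes_AX,Y)$ and $g\in\operatorname{Hom}_A(N\otimes_BY,X)$ (the action being matrix multiplication). A left module $Z$ over an Artin algebra $\Lambda$ is semi-Gorenstein-projective if $\operatorname{Ext}^i_\Lambda(Z,\Lambda)=0$ for all $i\ge1$. *)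

(* Defs.v *)
From HB Require Import structures.
From mathcomp Require Import all_boot all_algebra all_classical.
From mathcomp Require Import generic_quotient ring_quotient.
From mathcomp.multinomials Require Import freeg.

Set Implicit Arguments.
Unset Strict Implicit.
Unset Printing Implicit Defensive.

Import GRing.Theory.
Local Open Scope ring_scope.
Local Open Scope quotient_scope.

Definition surjective (T U : Type) (h : T -> U) : Prop :=
  forall y, exists x, h x = y.

Section Modules.
Context {S : pzRingType}.

Definition fin_gen (V : lmodType S) : Prop :=
  exists s : seq V, forall v, exists c : 'I_(size s) -> S,
    v = \sum_i c i *: s`_i.

Definition projective (P : lmodType S) : Prop :=
  forall (U V : lmodType S) (p : {linear U -> V}) (h : {linear P -> V}),
    surjective p ->
    exists k : {linear P -> U}, forall x, p (k x) = h x.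

End Modules.

Arguments fin_gen S V : clear implicits.
Arguments projective S P : clear implicits.

Section Artinian.
Variable R : comNzRingType.

Definition ideal (I : set R) : Prop :=
  [/\ I 0, forall x y, I x -> I y -> I (x + y) & forall r x, I x -> I (r * x)].

Definition artinian : Prop :=
  forall I : nat -> set R, (forall n, ideal (I n)) ->
    (forall n, (I n.+1 `<=` I n)%classic) ->
    exists n, forall m, (n <= m)%N -> I m = I n.

End Artinian.

Definition artin_algebra (R : comNzRingType) (A : algType R) : Prop :=
  artinian R /\ fin_gen R A.

(* Restriction of scalars along the structure map r |-> r%:A of an R-algebra. *)
Section Restriction.
Context {R : comNzRingType} {A : algType R}.

Definition restr (M : lmodType A) : Type := M.

Variable M : lmodType A.
HB.instance Definition _ := GRing.Zmodule.on (restr M).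

Definition restr_scale (r : R) (m : restr M) : restr M := r%:A *: (m : M).

Fact restr_scaleA a b m :
  restr_scale a (restr_scale b m) = restr_scale (a * b) m.
Proof. by rewrite /restr_scale scalerA -scalerAl mul1r scalerA. Qed.

Fact restr_scale1 : left_id 1 restr_scale.
Proof. by move=> m; rewrite /restr_scale !scale1r. Qed.

Fact restr_scaleDr : right_distributive restr_scale +%R.
Proof. by move=> r m n; rewrite /restr_scale scalerDr. Qed.

Fact restr_scaleDl m : {morph restr_scale^~ m : a b / a + b}.
Proof. by move=> a b; rewrite /restr_scale !scalerDl. Qed.

HB.instance Definition _ := GRing.Zmodule_isLmodule.Build R (restr M)
  restr_scaleA restr_scale1 restr_scaleDr restr_scaleDl.

End Restriction.

(* bimodType B A: B-A-bimodules over the R-algebras B and A, on which R acts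
   centrally (ractC); the right action of a on m is  ract m a. *)
HB.mixin Record Lmodule_isBimodule (R : comNzRingType) (B A : algType R) M
    of GRing.Lmodule B M := {
  ract : M -> A -> M;
  ractDl : forall a, {morph ract^~ a : m m' / m + m'};
  ractDr : forall m, {morph ract m : a a' / a + a'};
  ract1 : forall m, ract m 1 = m;
  ractA : forall m a a', ract (ract m a) a' = ract m (a * a');
  ractZ : forall b m a, ract (b *: m) a = b *: ract m a;
  ractC : forall (r : R) m, ract m r%:A = (r%:A : B) *: m
}.

#[short(type="bimodType")]
HB.structure Definition Bimodule (R : comNzRingType) (B A : algType R) :=
  { M of GRing.Lmodule B M & Lmodule_isBimodule R B A M }.

Arguments bimodType {R} B A.

(* The underlying right A-module, as a left module over A^c. *)
Section RightModule.
Context {R : comNzRingType} {B A : algType R}.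

Definition right_mod (M : bimodType B A) : Type := M.

Variable M : bimodType B A.
HB.instance Definition _ := GRing.Zmodule.on (right_mod M).

Definition right_scale (a : A^c) (m : right_mod M) : right_mod M :=
  ract (m : M) (a : A).

Fact right_scaleA a b m :
  right_scale a (right_scale b m) = right_scale (a * b) m.
Proof. exact: ractA. Qed.

Fact right_scale1 : left_id 1 right_scale.
Proof. exact: ract1. Qed.

Fact right_scaleDr : right_distributive right_scale +%R.
Proof. by move=> a m n; apply: ractDl. Qed.

Fact right_scaleDl m : {morph right_scale^~ m : a b / a + b}.
Proof. exact: ractDr. Qed.

HB.instance Definition _ := GRing.Zmodule_isLmodule.Build A^c (right_mod M)
  right_scaleA right_scale1 right_scaleDr right_scaleDl.

End RightModule.

Section FreeModule.
Context {S : nzRingType} {K : choiceType}.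

Lemma freegE (u : {freeg K / S}) :
  u = \sum_(k <- dom u) coeff k u *: << k >>.
Proof.
rewrite -[LHS]freeg_sumE; apply: eq_bigr => k _.
by apply/eqP/freeg_eqP => x; rewrite coeffZ !coeffU mul1r.
Qed.

Lemma freeg_lin_ext (V : lmodType S) (h k : {linear {freeg K / S} -> V}) :
  (forall x, h << x >> = k << x >>) -> h =1 k.
Proof.
move=> hk u; rewrite (freegE u) !linear_sum; apply: eq_bigr => x _.
by rewrite !linearZ hk.
Qed.

Variables (V : lmodType S) (h : K -> V).

HB.instance Definition _ := GRing.isZmodMorphism.Build {freeg K / S} V
  (fglift h) (lift_is_additive h).

Fact fglift_scalable : scalable (fglift h).
Proof.
move=> c u; have lift_sum (w : {freeg K / S}) :
    fglift h w = \sum_(k <- dom w) coeff k w *: h k.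
  by rewrite -{1}(freeg_sumE w) raddf_sum; apply: eq_bigr => k _ /=; rewrite liftU.
rewrite {1}/GRing.scale /= /fgscale raddf_sum lift_sum scaler_sumr.
by apply: eq_bigr => k _ /=; rewrite liftU scalerA.
Qed.

HB.instance Definition _ := GRing.isScalable.Build S {freeg K / S} V *:%R
  (fglift h) fglift_scalable.

Lemma fgliftU x : fglift h << x >> = h x.
Proof. by rewrite liftU scale1r. Qed.

End FreeModule.

Lemma freeg_projective (S : nzRingType) (K : choiceType) :
  projective S {freeg K / S}.
Proof.
move=> U V p h p_surj; pose k x := projT1 (cid (p_surj (h << x >>))).
exists (fglift k) => u.
apply: (@freeg_lin_ext S K V (p \o fglift k) h _ u) => x /=.
by rewrite fgliftU /k; case: cid.
Qed.

(* M (x)_A X is the quotient of the free abelian group on M * X by the subgroup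
   tensor_rel generated by the additivity and balancing relations. *)
Section Tensor.
Context {R : comNzRingType} {B A : algType R}.
Variables (M : bimodType B A) (X : lmodType A).

Local Notation F := {freeg (M * X)%type / int}.

Inductive tensor_rel : F -> Prop :=
| tensor_rel0 : tensor_rel 0
| tensor_relB u v : tensor_rel u -> tensor_rel v -> tensor_rel (u - v)
| tensor_rel_addl m m' x :
    tensor_rel (<< (m + m', x) >> - << (m, x) >> - << (m', x) >>)
| tensor_rel_addr m x x' :
    tensor_rel (<< (m, x + x') >> - << (m, x) >> - << (m, x') >>)
| tensor_rel_bal m a x :
    tensor_rel (<< (ract m a, x) >> - << (m, a *: x) >>).

Definition tensor_null : {pred F} := fun u => `[< tensor_rel u >].

Fact tensor_null_zmod : zmod_closed tensor_null.
Proof.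
split=> [|u v /asboolP u0 /asboolP v0]; first exact/asboolP/tensor_rel0.
exact/asboolP/tensor_relB.
Qed.

HB.instance Definition _ :=
  GRing.isZmodClosed.Build F tensor_null tensor_null_zmod.

Definition tensor : Type := Quotient.quot tensor_null.
HB.instance Definition _ := GRing.Zmodule.on tensor.

Definition tensor_pi : F -> tensor := \pi_(Quotient.quot tensor_null).

Fact tensor_pi_additive : zmod_morphism tensor_pi.
Proof. exact: (pi_is_zmod_morphism (Quotient.quot tensor_null)). Qed.

HB.instance Definition _ :=
  GRing.isZmodMorphism.Build F tensor tensor_pi tensor_pi_additive.

Definition tens (m : M) (x : X) : tensor := tensor_pi << (m, x) >>.

Lemma tensor_piP (t : tensor) : exists u, t = tensor_pi u.
Proof. by exists (repr t); rewrite /tensor_pi reprK. Qed.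

Lemma tensor_pi_eq0 u : tensor_pi u = 0 <-> tensor_rel u.
Proof.
have -> : tensor_pi u = 0 <-> tensor_pi u = tensor_pi 0 by rewrite raddf0.
have := Quotient.idealrBE tensor_null u 0; rewrite subr0 => E.
split=> [/eqP|u0]; first by rewrite -E => /asboolP.
by apply/eqP; rewrite -E; apply/asboolP.
Qed.

Lemma tensDl m m' x : tens (m + m') x = tens m x + tens m' x.
Proof.
apply/eqP; rewrite -subr_eq0 opprD addrA -!raddfB /=.
exact/eqP/tensor_pi_eq0/tensor_rel_addl.
Qed.

Lemma tensDr m x x' : tens m (x + x') = tens m x + tens m x'.
Proof.
apply/eqP; rewrite -subr_eq0 opprD addrA -!raddfB /=.
exact/eqP/tensor_pi_eq0/tensor_rel_addr.
Qed.

Lemma tens0l x : tens 0 x = 0.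
Proof. by apply: (addrI (tens 0 x)); rewrite -tensDl !addr0. Qed.

Lemma tens0r m : tens m 0 = 0.
Proof. by apply: (addrI (tens m 0)); rewrite -tensDr !addr0. Qed.

Lemma tens_bal m a x : tens (ract m a) x = tens m (a *: x).
Proof.
apply/eqP; rewrite -subr_eq0 -!raddfB /=.
exact/eqP/tensor_pi_eq0/tensor_rel_bal.
Qed.

Lemma freeg_add_ext (V : zmodType) (h k : {additive F -> V}) :
  (forall m x, h << (m, x) >> = k << (m, x) >>) -> h =1 k.
Proof.
move=> hk u; rewrite (freegE u) !raddf_sum; apply: eq_bigr => -[m x] _.
by rewrite -[coeff _ _]intz scaler_int !raddfMz hk.
Qed.

Lemma tensor_ext (V : zmodType) (h k : {additive tensor -> V}) :
  (forall m x, h (tens m x) = k (tens m x)) -> h =1 k.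
Proof.
move=> hk t; have [u ->] := tensor_piP t.
exact: (@freeg_add_ext V (h \o tensor_pi) (k \o tensor_pi)).
Qed.

Section Lift.
Variables (V : zmodType) (h : M -> X -> V).
Hypotheses (hDl : forall x, {morph h^~ x : m m' / m + m'})
  (hDr : forall m, {morph h m : x x' / x + x'})
  (hbal : forall m a x, h (ract m a) x = h m (a *: x)).

Let lift0 : F -> zmodule V := fglift (fun p : M * X => h p.1 p.2 : zmodule V).

Definition tensor_lift (t : tensor) : V := lift0 (repr t).

Let lift0B : {morph lift0 : u v / u - v}.
Proof. exact: raddfB. Qed.

Let lift0U m x : lift0 << (m, x) >> = h m x.
Proof. exact: fgliftU. Qed.

Let lift0_rel u : tensor_rel u -> lift0 u = 0.
Proof.
elim=> [|v w _ v0 _ w0|m m' x|m x x'|m a x].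
- exact: raddf0.
- by rewrite lift0B v0 w0 subr0.
- by rewrite !lift0B !lift0U hDl addrAC addrK subrr.
- by rewrite !lift0B !lift0U hDr addrAC addrK subrr.
- by rewrite lift0B !lift0U hbal subrr.
Qed.

Let tensor_lift_pi u : tensor_lift (tensor_pi u) = lift0 u.
Proof.
apply/eqP; rewrite -subr_eq0 -lift0B; apply/eqP/lift0_rel.
by apply/tensor_pi_eq0; rewrite raddfB /= {1}/tensor_pi reprK subrr.
Qed.

Lemma tensor_liftU m x : tensor_lift (tens m x) = h m x.
Proof. by rewrite tensor_lift_pi lift0U. Qed.

Lemma tensor_lift_additive : zmod_morphism tensor_lift.
Proof.
move=> s t; have [u ->] := tensor_piP s; have [v ->] := tensor_piP t.
by rewrite -raddfB !tensor_lift_pi lift0B.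
Qed.

Lemma tensor_lift_eq0 m x : tens m x = 0 -> h m x = 0.
Proof.
move=> mx0; rewrite -tensor_liftU mx0.
by have := tensor_lift_additive 0 0; rewrite !subrr.
Qed.

End Lift.

Definition tensor_scale (b : B) : tensor -> tensor :=
  tensor_lift (fun m x => tens (b *: m) x).

Fact tensor_scaleU b m x : tensor_scale b (tens m x) = tens (b *: m) x.
Proof.
rewrite /tensor_scale tensor_liftU // => {m x} [x m m'|m x x'|m a x].
- by rewrite scalerDr tensDl.
- exact: tensDr.
- by rewrite -ractZ tens_bal.
Qed.

Fact tensor_scaleB b : zmod_morphism (tensor_scale b).
Proof.
apply: tensor_lift_additive => [x m m'|m x x'|m a x].
- by rewrite scalerDr tensDl.
- exact: tensDr.
- by rewrite -ractZ tens_bal.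
Qed.

HB.instance Definition _ b :=
  GRing.isZmodMorphism.Build tensor tensor (tensor_scale b) (tensor_scaleB b).

Fact tensor_scaleA a b t :
  tensor_scale a (tensor_scale b t) = tensor_scale (a * b) t.
Proof.
apply: (@tensor_ext _ (tensor_scale a \o tensor_scale b) (tensor_scale (a * b))).
by move=> m x /=; rewrite !tensor_scaleU scalerA.
Qed.

Fact tensor_scale1 : left_id 1 tensor_scale.
Proof.
apply: (@tensor_ext _ (tensor_scale 1) idfun) => m x /=.
by rewrite tensor_scaleU scale1r.
Qed.

Fact tensor_scaleDr : right_distributive tensor_scale +%R.
Proof. by move=> b s t; apply: raddfD. Qed.

Fact tensor_scaleDl t : {morph tensor_scale^~ t : a b / a + b}.
Proof.
move=> a b.
apply: (@tensor_ext _ (tensor_scale (a + b)) (tensor_scale a \+ tensor_scale b)).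
by move=> m x /=; rewrite !tensor_scaleU scalerDl tensDl.
Qed.

HB.instance Definition _ := GRing.Zmodule_isLmodule.Build B tensor
  tensor_scaleA tensor_scale1 tensor_scaleDr tensor_scaleDl.

Lemma tensZl b m x : b *: tens m x = tens (b *: m) x.
Proof. exact: tensor_scaleU. Qed.

End Tensor.

Section linHom.
Context {S : nzRingType}.

Definition linHom (U V : lmodType S) : Type := {linear U -> V}.

Section Group.
Variables U V : lmodType S.
Implicit Types h k l : linHom U V.

HB.instance Definition _ := gen_eqMixin (linHom U V).
HB.instance Definition _ := gen_choiceMixin (linHom U V).

Lemma Hom_ext h k : h =1 k -> h = k.
Proof.
case: h k => [h [[h1] [h2]]] [k [[k1] [k2]]] /= /funext hk; subst k.
by congr (GRing.Linear.Pack (GRing.Linear.Class _ _)); congr (_ _);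
  apply: Prop_irrelevance.
Qed.

Definition Hom0 : linHom U V := \0.
Definition Hom_opp h : linHom U V := \- h.
Definition Hom_add h k : linHom U V := h \+ k.

Fact Hom_addA : associative Hom_add.
Proof. by move=> h k l; apply: Hom_ext => x /=; rewrite addrA. Qed.
Fact Hom_addC : commutative Hom_add.
Proof. by move=> h k; apply: Hom_ext => x /=; rewrite addrC. Qed.
Fact Hom_add0 : left_id Hom0 Hom_add.
Proof. by move=> h; apply: Hom_ext => x /=; rewrite add0r. Qed.
Fact Hom_addN : left_inverse Hom0 Hom_opp Hom_add.
Proof. by move=> h; apply: Hom_ext => x /=; rewrite addNr. Qed.

HB.instance Definition _ := GRing.isZmodule.Build (linHom U V)
  Hom_addA Hom_addC Hom_add0 Hom_addN.

End Group.

Definition Hom_map (U' U : lmodType S) (h : {linear U' -> U}) (V : lmodType S)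
  (k : linHom U V) : linHom U' V := (k : {linear U -> V}) \o h.

Fact Hom_map_additive (U' U : lmodType S) (h : {linear U' -> U}) V :
  zmod_morphism (@Hom_map U' U h V).
Proof. by move=> k l; apply: Hom_ext. Qed.

HB.instance Definition _ (U' U : lmodType S) (h : {linear U' -> U}) V :=
  GRing.isZmodMorphism.Build (linHom U V) (linHom U' V) (Hom_map h (V := V))
    (Hom_map_additive h (V := V)).

End linHom.

Arguments Hom_map {S U' U} h V k.

(* H^n = ker d_n / im d_(n-1), with im d_(-1) = 0.  That d_(n+1) d_n = 0 is not
   required: the coboundaries that are divided out are those that are cocycles. *)
Section Cohomology.
Variables (C : nat -> zmodType) (d : forall n, {additive C n -> C n.+1}).

Definition cocycle_pred n : {pred C n} := [pred c | d n c == 0].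

Fact cocycle_zmod n : zmod_closed (@cocycle_pred n).
Proof.
split=> [|b c]; rewrite !inE ?raddf0 // => /eqP b0 /eqP c0.
by rewrite raddfB b0 c0 subr0.
Qed.

HB.instance Definition _ n :=
  GRing.isZmodClosed.Build (C n) (@cocycle_pred n) (@cocycle_zmod n).

Record cocycle n : Type :=
  Cocycle { cocycle_val :> C n; _ : cocycle_val \in @cocycle_pred n }.

HB.instance Definition _ n := [isSub for @cocycle_val n].
HB.instance Definition _ n := [Choice of cocycle n by <:].
HB.instance Definition _ n := [SubChoice_isSubZmodule of cocycle n by <:].

Definition coboundary n : C n -> Prop :=
  match n with
  | 0 => fun c => c = 0
  | m.+1 => fun c => exists b : C m, c = d m b
  end.

Definition coboundary_pred n : {pred cocycle n} :=
  fun c => `[< coboundary (val c) >].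

Fact coboundary_zmod n : zmod_closed (@coboundary_pred n).
Proof.
split=> [|b c].
  by apply/asboolP; case: n => [//|n]; exists 0; rewrite !raddf0.
case: n b c => [|n] b c /asboolP bB /asboolP cB; apply/asboolP; rewrite raddfB.
  by rewrite /= bB cB subr0.
have [[b' bE] [c' cE]] := (bB, cB); exists (b' - c').
by rewrite raddfB -bE -cE.
Qed.

HB.instance Definition _ n := GRing.isZmodClosed.Build (cocycle n)
  (@coboundary_pred n) (@coboundary_zmod n).

Definition cohomology n : Type := Quotient.quot (@coboundary_pred n).
HB.instance Definition _ n := GRing.Zmodule.on (cohomology n).

Definition coh_class n (c : cocycle n) : cohomology n :=
  \pi_(Quotient.quot (@coboundary_pred n)) c.

Fact coh_class_additive n : zmod_morphism (@coh_class n).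
Proof. exact: (pi_is_zmod_morphism (Quotient.quot (@coboundary_pred n))). Qed.

HB.instance Definition _ n := GRing.isZmodMorphism.Build (cocycle n)
  (cohomology n) (@coh_class n) (@coh_class_additive n).

Lemma coh_classP n (e : cohomology n) : exists c, e = coh_class c.
Proof. by exists (repr e); rewrite /coh_class reprK. Qed.

Lemma coh_class_eq0 n (c : cocycle n) :
  coh_class c = 0 <-> coboundary (val c).
Proof.
have -> : coh_class c = 0 <-> coh_class c = coh_class 0 by rewrite raddf0.
have := Quotient.idealrBE (@coboundary_pred n) c 0; rewrite subr0 => E.
split=> [/eqP|c0]; first by rewrite -E => /asboolP.
by apply/eqP; rewrite -E; apply/asboolP.
Qed.

End Cohomology.

Section CohomologyMap.
Context {C D : nat -> zmodType}.
Context {dC : forall n, {additive C n -> C n.+1}}.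
Context {dD : forall n, {additive D n -> D n.+1}}.
Variables (f : forall n, {additive C n -> D n}).
Hypothesis fd : forall n c, f n.+1 (dC n c) = dD n (f n c).

Fact cocycle_map_subproof n (c : cocycle dC n) :
  f n (val c) \in @cocycle_pred D dD n.
Proof. by case: c => c /= /eqP c0; rewrite inE -fd c0 raddf0. Qed.

Definition cocycle_map n (c : cocycle dC n) : cocycle dD n :=
  Cocycle (cocycle_map_subproof c).

Definition coh_map n (e : cohomology dC n) : cohomology dD n :=
  coh_class (cocycle_map (repr e)).

Fact cocycle_map_additive n : zmod_morphism (@cocycle_map n).
Proof. by move=> b c; apply/val_inj; rewrite /= !raddfB. Qed.

Fact coboundary_map n (c : C n) : coboundary dC c -> coboundary dD (f n c).
Proof.
case: n c => [|n] c /= => [->|[b ->]]; first exact: raddf0.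
by exists (f n b); rewrite fd.
Qed.

Lemma coh_map_class n (c : cocycle dC n) :
  coh_map (coh_class c) = coh_class (cocycle_map c).
Proof.
apply/eqP; rewrite -subr_eq0 -raddfB -cocycle_map_additive; apply/eqP.
apply/coh_class_eq0; set b := repr _ - c.
have /coh_class_eq0 : coh_class b = 0.
  by rewrite raddfB /= {1}/coh_class reprK subrr.
exact: coboundary_map.
Qed.

Fact coh_map_additive n : zmod_morphism (@coh_map n).
Proof.
move=> s t; have [b ->] := coh_classP s; have [c ->] := coh_classP t.
by rewrite -raddfB !coh_map_class cocycle_map_additive raddfB.
Qed.

End CohomologyMap.

(* Every module X is covered by the free module on its underlying set; iterating
   on the kernels gives a free resolution that is functorial in X. *)
Section Resolution.
Context {S : nzRingType}.
Implicit Types X Y Z V : lmodType S.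

Definition aug X : {freeg X / S} -> X := fglift id.
HB.instance Definition _ X := GRing.Linear.on (@aug X).

Definition aug_ker X : {pred {freeg X / S}} := [pred u | aug u == 0].

Fact aug_ker_submod X : submod_closed (@aug_ker X).
Proof.
split=> [|a u v]; rewrite !inE ?raddf0 // => /eqP u0 /eqP v0.
by rewrite linearP /= u0 v0 scaler0 addr0.
Qed.

HB.instance Definition _ X := GRing.isSubmodClosed.Build S {freeg X / S}
  (@aug_ker X) (@aug_ker_submod X).

Record syzygy X : Type :=
  Syzygy { syzygy_val :> {freeg X / S}; _ : syzygy_val \in @aug_ker X }.

HB.instance Definition _ X := [isSub for @syzygy_val X].
HB.instance Definition _ X := [Choice of syzygy X by <:].
HB.instance Definition _ X := [SubChoice_isSubLmodule of syzygy X by <:].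

Fixpoint syz n X : lmodType S :=
  if n is m.+1 then syzygy (syz m X) else X.

Definition res n X : lmodType S := {freeg (syz n X) / S}.

Definition res_d n X : {linear res n.+1 X -> res n X} :=
  (val : {linear syzygy (syz n X) -> res n X}) \o @aug (syz n.+1 X).

Section Functoriality.
Variables (X Y : lmodType S) (h : {linear X -> Y}).

Definition free_map : {linear {freeg X / S} -> {freeg Y / S}} :=
  fglift (fun x => << h x >> : {freeg Y / S}).

Lemma aug_free_map u : aug (free_map u) = h (aug u).
Proof.
apply: (@freeg_lin_ext _ _ _ (@aug Y \o free_map) (h \o @aug X)) => x /=.
by rewrite /aug !fgliftU.
Qed.

Fact syzygy_map_subproof (u : syzygy X) : free_map (val u) \in @aug_ker Y.
Proof. by case: u => u /= /eqP u0; rewrite inE aug_free_map u0 raddf0. Qed.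

Definition syzygy_map (u : syzygy X) : syzygy Y :=
  Syzygy (syzygy_map_subproof u).

Fact syzygy_map_linear : linear syzygy_map.
Proof. by move=> a u v; apply/val_inj; rewrite /= !linearP. Qed.

HB.instance Definition _ :=
  GRing.isLinear.Build S (syzygy X) (syzygy Y) *:%R syzygy_map syzygy_map_linear.

End Functoriality.

Fixpoint syz_map n X Y (h : {linear X -> Y}) : {linear syz n X -> syz n Y} :=
  if n is m.+1 then syzygy_map (syz_map m h) else h.

Definition res_map n X Y (h : {linear X -> Y}) : {linear res n X -> res n Y} :=
  free_map (syz_map n h).

Lemma res_d_map n X Y (h : {linear X -> Y}) u :
  res_d n Y (res_map n.+1 h u) = res_map n h (res_d n X u).
Proof. by rewrite /= aug_free_map. Qed.

Lemma aug_surj X : surjective (@aug X).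
Proof. by move=> x; exists << x >>; rewrite /aug fgliftU. Qed.

Lemma res_exact n X (u : res n X) :
  (exists w, u = res_d n X w) <->
  match n return res n X -> Prop with
  | 0 => fun u => aug u = 0
  | m.+1 => fun u => res_d m X u = 0
  end u.
Proof.
have -> : (exists w, u = res_d n X w) <-> aug u = 0.
  split=> [[w ->]|u0]; first by rewrite /=; case: (aug w) => v /= /eqP.
  have u_in : u \in @aug_ker (syz n X) by apply/eqP.
  by have [w wE] := @aug_surj (syz n.+1 X) (Syzygy u_in); exists w; rewrite /= wE.
case: n u => [//|n] u; split=> [/= -> //|/= u0].
exact: val_inj.
Qed.

(* Ext^n_S(X, V) is the cohomology of Hom_S(-, V) of this resolution of X. *)
Definition ext_d X V n : {additive linHom (res n X) V -> linHom (res n.+1 X) V} :=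
  Hom_map (res_d n X) V.

Definition Ext n X V : zmodType := cohomology (ext_d X V) n.

Fact ext_map_comm X Y (h : {linear X -> Y}) V n c :
  Hom_map (res_map n.+1 h) V (ext_d Y V n c) =
  ext_d X V n (Hom_map (res_map n h) V c).
Proof. by apply: Hom_ext => u; rewrite /= aug_free_map. Qed.

Definition Ext_map n X Y (h : {linear X -> Y}) V : Ext n Y V -> Ext n X V :=
  @coh_map _ _ _ _ (fun n => Hom_map (res_map n h) V : {additive _ -> _})
    (@ext_map_comm X Y h V) n.

Fact Ext_map_additive n X Y (h : {linear X -> Y}) V :
  zmod_morphism (@Ext_map n X Y h V).
Proof. exact: coh_map_additive. Qed.

End Resolution.

Arguments Ext_map {S} n {X Y} h V.

Definition semi_Gorenstein_projective (S : nzRingType) (Z : lmodType S) : Prop :=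
  forall i, (1 <= i)%N -> forall e : Ext i Z S^o, e = 0.

(* The Morita ring whose bimodule maps M (x)_A N -> B and N (x)_B M -> A are 0,
   the only possibility when both tensor products vanish.  ((a, n), (m, b))
   stands for the matrix with rows (a n) and (m b). *)
Section Morita.
Context {R : comNzRingType} {A B : algType R}.

Definition morita (M : bimodType B A) (N : bimodType A B) : Type :=
  ((A * N) * (M * B))%type.

Variables (M : bimodType B A) (N : bimodType A B).
Local Notation L := (morita M N).

HB.instance Definition _ := GRing.Zmodule.on L.

Definition morita_one : L := ((1, 0), (0, 1)).

Definition morita_mul (l l' : L) : L :=
  let: ((a, n), (m, b)) := l in let: ((a', n'), (m', b')) := l' in
  ((a * a', a *: n' + ract n b'), (ract m a' + b *: m', b * b')).

Definition morita_scale (r : R) (l : L) : L :=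
  let: ((a, n), (m, b)) := l in
  ((r *: a, r%:A *: n), (r%:A *: m, r *: b)).

Let ract0l (B' A' : algType R) (P : bimodType B' A') a : ract (0 : P) a = 0.
Proof. by apply: (addrI (ract 0 a)); rewrite -ractDl !addr0. Qed.

Let ract0r (B' A' : algType R) (P : bimodType B' A') (p : P) : ract p 0 = 0.
Proof. by apply: (addrI (ract p 0)); rewrite -ractDr !addr0. Qed.

Fact morita_mulA : associative morita_mul.
Proof.
move=> [[a n] [m b]] [[a' n'] [m' b']] [[a'' n''] [m'' b'']] /=.
congr ((_, _), (_, _)); rewrite ?mulrA //.
- by rewrite scalerDr scalerA ractDl ractZ ractA addrA.
- by rewrite scalerDr scalerA ractDl ractZ ractA addrA.
Qed.

Fact morita_mul1 : left_id morita_one morita_mul.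
Proof.
move=> [[a n] [m b]] /=.
by rewrite !mul1r !scale1r !ract0l addr0 add0r.
Qed.

Fact morita_mulr1 : right_id morita_one morita_mul.
Proof.
move=> [[a n] [m b]] /=.
by rewrite !mulr1 !scaler0 !ract1 addr0 add0r.
Qed.

Fact morita_mulDl : left_distributive morita_mul +%R.
Proof.
move=> [[a n] [m b]] [[a' n'] [m' b']] [[a'' n''] [m'' b'']] /=.
by congr ((_, _), (_, _)); rewrite /= ?mulrDl // ?scalerDl ?ractDl addrACA.
Qed.

Fact morita_mulDr : right_distributive morita_mul +%R.
Proof.
move=> [[a n] [m b]] [[a' n'] [m' b']] [[a'' n''] [m'' b'']] /=.
by congr ((_, _), (_, _)); rewrite /= ?mulrDr // ?scalerDr ?ractDr addrACA.
Qed.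

Fact morita_one_neq0 : morita_one != 0.
Proof. by apply/eqP => -[/eqP]; rewrite oner_eq0. Qed.

HB.instance Definition _ := GRing.Zmodule_isNzRing.Build L
  morita_mulA morita_mul1 morita_mulr1 morita_mulDl morita_mulDr
  morita_one_neq0.

Fact morita_scaleA r s l :
  morita_scale r (morita_scale s l) = morita_scale (r * s) l.
Proof.
case: l => [[a n] [m b]] /=.
by rewrite !scalerA -!scalerAl !mul1r !scalerA.
Qed.

Fact morita_scale1 : left_id 1 morita_scale.
Proof. by move=> [[a n] [m b]] /=; rewrite !scale1r. Qed.

Fact morita_scaleDr : right_distributive morita_scale +%R.
Proof.
by move=> r [[a n] [m b]] [[a' n'] [m' b']] /=; rewrite !scalerDr.
Qed.

Fact morita_scaleDl l : {morph morita_scale^~ l : r s / r + s}.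
Proof. by case: l => [[a n] [m b]] r s /=; rewrite !scalerDl. Qed.

HB.instance Definition _ := GRing.Zmodule_isLmodule.Build R L
  morita_scaleA morita_scale1 morita_scaleDr morita_scaleDl.

Fact morita_scaleAl (r : R) (l l' : L) : r *: (l * l') = (r *: l) * l'.
Proof.
case: l l' => [[a n] [m b]] [[a' n'] [m' b']]; congr ((_, _), (_, _)) => /=.
- by rewrite scalerAl.
- by rewrite scalerDr scalerA -scalerAl mul1r ractZ.
- by rewrite scalerDr scalerA -scalerAl mul1r ractZ.
- by rewrite scalerAl.
Qed.

HB.instance Definition _ :=
  GRing.LSemiModule_isLSemiAlgebra.Build R L morita_scaleAl.

Fact morita_scaleAr (r : R) (l l' : L) : r *: (l * l') = l * (r *: l').
Proof.
case: l l' => [[a n] [m b]] [[a' n'] [m' b']]; congr ((_, _), (_, _)) => /=.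
- by rewrite scalerAr.
- rewrite scalerDr !scalerA -scalerAl mul1r -scalerAr mulr1; congr (_ + _).
  by rewrite -ractC ractA -scalerAr mulr1.
- rewrite scalerDr !scalerA -scalerAl mul1r -scalerAr mulr1; congr (_ + _).
  by rewrite -ractC ractA -scalerAr mulr1.
- by rewrite scalerAr.
Qed.

HB.instance Definition _ :=
  GRing.Lalgebra_isAlgebra.Build R L morita_scaleAr.

End Morita.

(* The left module with components X, Y and structure maps f, g.  Associativity
   of the action needs the vanishing of M (x)_A N and N (x)_B M. *)
Section MoritaModule.
Context {R : comNzRingType} {A B : algType R}.
Context {M : bimodType B A} {N : bimodType A B}.
Local Notation L := (morita M N).

Definition morita_mod (MN0 : forall t : tensor M N, t = 0)
    (NM0 : forall t : tensor N M, t = 0) (X : lmodType A) (Y : lmodType B)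
    (f : {linear tensor M X -> Y}) (g : {linear tensor N Y -> X}) : Type :=
  (X * Y)%type.

Variables (MN0 : forall t : tensor M N, t = 0).
Variables (NM0 : forall t : tensor N M, t = 0).
Variables (X : lmodType A) (Y : lmodType B).
Variables (f : {linear tensor M X -> Y}) (g : {linear tensor N Y -> X}).
Local Notation Z := (morita_mod MN0 NM0 f g).

HB.instance Definition _ := GRing.Zmodule.on Z.

Definition morita_mod_scale (l : L) (z : Z) : Z :=
  let: ((a, n), (m, b)) := l in let: (x, y) := z in
  (a *: x + g (tens n y), f (tens m x) + b *: y).

Fact morita_mod_gf n m x : g (tens n (f (tens m x))) = 0.
Proof.
apply: (@tensor_lift_eq0 _ _ _ N M _ (fun n m => g (tens n (f (tens m x))))).
- by move=> m' n1 n2; rewrite tensDl raddfD.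
- by move=> n' m1 m2; rewrite tensDl raddfD /= tensDr raddfD.
- by move=> n' b m'; rewrite tens_bal -linearZ_LR /= tensZl.
- exact: NM0.
Qed.

Fact morita_mod_fg m n y : f (tens m (g (tens n y))) = 0.
Proof.
apply: (@tensor_lift_eq0 _ _ _ M N _ (fun m n => f (tens m (g (tens n y))))).
- by move=> n' m1 m2; rewrite tensDl raddfD.
- by move=> m' n1 n2; rewrite tensDl raddfD /= tensDr raddfD.
- by move=> m' a n'; rewrite tens_bal -linearZ_LR /= tensZl.
- exact: MN0.
Qed.

Fact morita_mod_scaleA k l z :
  morita_mod_scale k (morita_mod_scale l z) = morita_mod_scale (k * l) z.
Proof.
case: k l z => [[a n] [m b]] [[a' n'] [m' b']] [x y] /=; congr (_, _).
- rewrite !tensDr !raddfD /= morita_mod_gf add0r ?scalerDr !scalerA.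
  by rewrite !tensDl !raddfD /= tens_bal -tensZl linearZ_LR addrA.
- rewrite !tensDr !raddfD /= morita_mod_fg addr0 ?scalerDr !scalerA.
  by rewrite !tensDl !raddfD /= tens_bal -tensZl linearZ_LR addrA.
Qed.

Fact morita_mod_scale1 : left_id 1 morita_mod_scale.
Proof.
move=> [x y]; rewrite /= !scale1r.
by rewrite !tens0l !raddf0 addr0 add0r.
Qed.

Fact morita_mod_scaleDr : right_distributive morita_mod_scale +%R.
Proof.
move=> [[a n] [m b]] [x y] [x' y'] /=.
by congr (_, _) => /=; rewrite !scalerDr !tensDr !raddfD addrACA.
Qed.

Fact morita_mod_scaleDl z : {morph morita_mod_scale^~ z : k l / k + l}.
Proof.
case: z => x y [[a n] [m b]] [[a' n'] [m' b']] /=.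
by congr (_, _) => /=; rewrite !scalerDl !tensDl !raddfD addrACA.
Qed.

HB.instance Definition _ := GRing.Zmodule_isLmodule.Build L Z
  morita_mod_scaleA morita_mod_scale1 morita_mod_scaleDr morita_mod_scaleDl.

End MoritaModule.

Arguments morita_mod {R A B M N} MN0 NM0 {X Y} f g.

(* Main.v *)
(* Let F be the canonical free Lambda-resolution of Z = (X, Y).  Its A-components P
   and B-components Q are projective resolutions of X and Y, because A + N and M + B
   are projective; N (x) Q and M (x) P are projective resolutions of N (x) Y and
   M (x) X, because N_B and M_A are flat; and the structure maps g_n : N (x) Q_n -> P_n
   and f_n : M (x) P_n -> Q_n lift g and f.  So the four conditions say that
   g^* : Hom(P, A) -> Hom(N (x) Q, A) and f^* : Hom(Q, B) -> Hom(M (x) P, B) are onto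
   on H^0 and bijective on H^i, i >= 1.

   A cochain of F with values in the first column (A, M) of Lambda is a pair
   u : P_i -> A, v : Q_i -> M with u g = 0 and v (f (m (x) x)) = m u(x).  As F_i
   is free, every map N (x) Q_i -> U factors through g_i, and similarly for f_i.
   - If these columns are acyclic in positive degrees, extend a cocycle w on N (x) Q_i
     to u on P_i and pick v on Q_i with v f = M (x) u: then (d u, d v) is a column
     cocycle, hence d (u', v'), and u - u' is a cocycle restricting to w, so g^* is
     onto.  If u g = 0 for a cocycle u, ontoness of f^* with coefficients in M gives a
     cocycle v completing u to a column cocycle, so u is a coboundary and g^* is
     injective.
   - Conversely the conditions make the cochains u with u g = 0, and v with v f = 0,
     acyclic, and columns are an extension of the former by the latter.
   Coefficients in M reduce to coefficients in B by a finite dual basis of M over B. *)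
Require Import Defs.
From HB Require Import structures.
From mathcomp Require Import all_boot all_algebra all_classical.
From mathcomp.multinomials Require Import freeg.

Set Implicit Arguments.
Unset Strict Implicit.
Unset Printing Implicit Defensive.

Import GRing.Theory.
Local Open Scope ring_scope.

(** * Lifting along maps that need not be onto, and dual bases *)

Section LinearMaps.
Context {S : nzRingType}.
Implicit Types U V W : lmodType S.

Definition linmap U V (h : U -> V) (h_lin : linear h) : {linear U -> V} :=
  HB.pack h (GRing.isLinear.Build S U V *:%R h h_lin).

Section Pullback.
Variables (P U V : lmodType S) (h : {linear P -> V}) (p : {linear U -> V}).

Definition pullback_pred : {pred P * U} := [pred z | h z.1 == p z.2].

Fact pullback_submod : submod_closed pullback_pred.
Proof.
split=> [|a z w]; rewrite !inE ?raddf0 // => /eqP hz /eqP hw.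
by rewrite !linearP /= hz hw.
Qed.

HB.instance Definition _ :=
  GRing.isSubmodClosed.Build S (P * U)%type pullback_pred pullback_submod.

Record pullback : Type :=
  Pullback { pullback_val :> P * U; _ : pullback_val \in pullback_pred }.

HB.instance Definition _ := [isSub for pullback_val].
HB.instance Definition _ := [Choice of pullback by <:].
HB.instance Definition _ := [SubChoice_isSubLmodule of pullback by <:].

(** The pullback of [h] and [p] surjects onto [P] because [h] takes its values in the image of [p].
    A section of this projection, followed by the projection to [U], is the lift; the image of [p]
    never has to be formed as a module. *)
Lemma projective_lift : projective S P -> (forall x, exists y, h x = p y) ->
  exists k : {linear P -> U}, forall x, p (k x) = h x.
Proof.
move=> P_proj hp.
pose q1 : {linear pullback -> P} := fst \o (val : {linear pullback -> (P * U)%type}).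
have q1_surj : surjective q1.
  move=> x; have [y hxy] := hp x.
  have xyP : (x, y) \in pullback_pred by rewrite inE /= hxy.
  by exists (Pullback xyP).
have [k kE] := P_proj _ _ q1 idfun q1_surj.
exists (snd \o (val : {linear pullback -> (P * U)%type}) \o k) => x /=.
by have /= := kE x; case: (k x) => z /= /eqP hz <-; rewrite hz.
Qed.

End Pullback.

(** A finite generating family gives a free cover of [P], which splits; the functionals are the
    coordinates of the splitting. *)
Lemma dual_basis (P : lmodType S) : fin_gen S P -> projective S P ->
  exists m, exists (s : 'I_m -> P) (b : 'I_m -> {linear P -> S^o}),
    forall x, x = \sum_i b i x *: s i.
Proof.
move=> [s sP] P_proj; pose p : {linear {freeg 'I_(size s) / S} -> P} :=
  fglift (fun i : 'I_(size s) => s`_i).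
have p_surj : surjective p.
  move=> x; have [c ->] := sP x; exists (\sum_i c i *: << i >>).
  by rewrite linear_sum; apply: eq_bigr => i _; rewrite linearZ /= fgliftU.
have [k kE] := P_proj _ _ p idfun p_surj.
pose cf i : {linear {freeg 'I_(size s) / S} -> S^o} :=
  fglift (fun j : 'I_(size s) => (i == j)%:R : S^o).
exists (size s), (fun i : 'I_(size s) => s`_i), (fun i => cf i \o k) => x.
rewrite -[LHS](kE x).
suff E : p =1 (fun u => \sum_i cf i u *: s`_i) by rewrite E.
(* Once the right-hand side is known to be linear in [u], the two sides need only be compared on the
   basis. *)
have Elin : linear (fun u => \sum_i cf i u *: s`_i).
  move=> a u v; rewrite scaler_sumr -big_split; apply: eq_bigr => i _ /=.
  by rewrite linearP scalerDl scalerA.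
apply: (@freeg_lin_ext _ _ _ p (linmap Elin)) => j /=.
rewrite fgliftU (bigD1 j) //= fgliftU eqxx scale1r big1 ?addr0 // => i /negPf ij.
by rewrite fgliftU ij scale0r.
Qed.

End LinearMaps.

(** * Projective resolutions *)

Section Resolutions.
Context {S : nzRingType}.
Implicit Types U V W X : lmodType S.

(** Arbitrary projective resolutions are considered because [res] does not commute with taking
    corners or with tensoring. *)
Record resolution X := Resolution {
  rmod : nat -> lmodType S;
  rd : forall n, {linear rmod n.+1 -> rmod n};
  raug : {linear rmod 0 -> X};
  rmod_proj : forall n, projective S (rmod n);
  raug_surj : surjective raug;
  raug_exact : forall x, raug x = 0 <-> exists y, x = rd 0 y;
  rd_exact : forall n x, rd n x = 0 <-> exists y, x = rd n.+1 y }.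

Arguments rd {X} r n.
Arguments raug {X} r.
Arguments rmod_proj {X} r n.
Arguments raug_surj {X} r.
Arguments raug_exact {X} r.
Arguments rd_exact {X} r n.

Lemma rdK X (P : resolution X) n x : rd P n (rd P n.+1 x) = 0.
Proof. by apply/rd_exact; exists x. Qed.

Lemma raugK X (P : resolution X) x : raug P (rd P 0 x) = 0.
Proof. by apply/raug_exact; exists x. Qed.

Arguments rdK {X} P n x.
Arguments raugK {X} P x.

Definition lifts X Y (P : resolution X) (Q : resolution Y) (h : {linear X -> Y})
    (a : forall n, {linear rmod P n -> rmod Q n}) : Prop :=
  (forall x, raug Q (a 0 x) = h (raug P x)) /\
  (forall n x, rd Q n (a n.+1 x) = a n (rd P n x)).

Section Lift.
Variables (X Y : lmodType S) (P : resolution X) (Q : resolution Y).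
Variable h : {linear X -> Y}.

(** The property stored with [a] is the invariant of the induction: [a] composed with the
    differential lands in the image of the differential, so [projective_lift] yields the next
    degree. *)
Let state n := {a : {linear rmod P n -> rmod Q n} |
  forall x, exists y, a (rd P n x) = rd Q n y}.

Let state0 : {s : state 0 | forall x, raug Q (sval s x) = h (raug P x)}.
Proof.
have [k /= kE] := cid (projective_lift (h := h \o raug P) (p := raug Q)
  (rmod_proj P 0) (fun x => let: ex_intro y e := raug_surj Q (h (raug P x)) in
     ex_intro _ y (esym e))).
have kP x : exists y, k (rd P 0 x) = rd Q 0 y.
  by apply/raug_exact; rewrite kE raugK raddf0.
by exists (exist _ k kP) => x; rewrite kE.
Qed.

Let stateS n (s : state n) :
  {t : state n.+1 | forall x, rd Q n (sval t x) = sval s (rd P n x)}.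
Proof.
case: s => a aP /=; have [k kE] := cid (projective_lift (rmod_proj P n.+1)
  (h := a \o rd P n) (p := rd Q n) aP).
have kP x : exists y, k (rd P n.+1 x) = rd Q n.+1 y.
  by apply/rd_exact; rewrite kE /= rdK raddf0.
by exists (exist _ k kP) => x; rewrite kE.
Qed.

Let Fixpoint states n : state n :=
  if n is m.+1 then sval (stateS (states m)) else sval state0.

Lemma lifts_ex : exists a, @lifts X Y P Q h a.
Proof.
exists (fun n => sval (states n)); split=> [|n] x /=; first by case: state0.
by case: (stateS _).
Qed.

End Lift.

Definition is_cocycle X (P : resolution X) V i (u : {linear rmod P i -> V}) :=
  forall x, u (rd P i x) = 0.

Definition is_coboundary X (P : resolution X) V i :
    ({linear rmod P i -> V}) -> Prop :=
  match i with
  | 0 => fun u => forall x, u x = 0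
  | j.+1 => fun u => exists b : {linear rmod P j -> V}, forall x, u x = b (rd P j x)
  end.

Lemma is_coboundaryD X (P : resolution X) V i (u v w : {linear rmod P i -> V}) :
  (forall x, w x = u x + v x) ->
  is_coboundary u -> is_coboundary v -> is_coboundary w.
Proof.
case: i u v w => [|i] u v w wE /=; first by move=> u0 v0 x; rewrite wE u0 v0 addr0.
by case=> b bE [c cE]; exists (b \+ c) => x; rewrite wE bE cE.
Qed.

Lemma is_coboundary_comp X Y (P : resolution X) (Q : resolution Y) h a V i
    (u : {linear rmod Q i -> V}) (w : {linear rmod P i -> V}) :
  @lifts X Y P Q h a -> (forall x, w x = u (a i x)) ->
  is_coboundary u -> is_coboundary w.
Proof.
case: i u w => [|i] u w [_ aE] wE /=; first by move=> u0 x; rewrite wE u0.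
by case=> b bE; exists (b \o a i) => x; rewrite wE bE /= aE.
Qed.

Lemma lifts_homotopic X Y (P : resolution X) (Q : resolution Y) h a b V i
    (u : {linear rmod Q i -> V}) (w : {linear rmod P i -> V}) :
  @lifts X Y P Q h a -> @lifts X Y P Q h b -> is_cocycle u ->
  (forall x, w x = u (a i x) - u (b i x)) -> is_coboundary w.
Proof.
move=> [a0 aS] [b0 bS] u0 wE.
have delta_aug x : raug Q (a 0 x - b 0 x) = 0 by rewrite raddfB /= a0 b0 subrr.
have deltaS n x : rd Q n (a n.+1 x - b n.+1 x) = a n (rd P n x) - b n (rd P n x).
  by rewrite raddfB /= aS bS.
(* Only the composite of the homotopy with d is carried along the induction. *)
have homotopy n : exists s : {linear rmod P n -> rmod Q n.+1},
    forall x, a n (rd P n x) - b n (rd P n x) = rd Q n (s (rd P n x)).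
  elim: n => [|n [s sE]].
    have [s sE] := projective_lift (rmod_proj P 0) (p := rd Q 0) (h := a 0 \- b 0)
      (fun x => (raug_exact Q _).1 (delta_aug x)).
    by exists s => x; rewrite sE.
  have sP x : exists y, ((a n.+1 \- b n.+1) \- (s \o rd P n)) x = rd Q n.+1 y.
    by apply/rd_exact; rewrite /= raddfB /= deltaS sE subrr.
  have [t tE] := projective_lift (rmod_proj P n.+1) sP.
  by exists t => x; rewrite tE /= rdK raddf0 subr0.
case: i u w u0 wE => [|i] u w u0 wE /=.
  move=> x; rewrite wE -raddfB.
  by have [y ->] := (raug_exact Q _).1 (delta_aug x); apply: u0.
have [s sE] := homotopy i; exists (u \o s) => x.
(* The difference of [a] and [b] agrees with [s] after the differential up to a boundary, and the
   cocycle [u] kills boundaries. *)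
have /(rd_exact Q) [y yE] : rd Q i (a i.+1 x - b i.+1 x - s (rd P i x)) = 0.
  by rewrite raddfB /= deltaS sE subrr.
by apply/eqP; rewrite wE -subr_eq0 /= -(u0 y) -yE !raddfB.
Qed.

(* Surjectivity and injectivity of H^i(Hom(Q, V)) -> H^i(Hom(P, V)). *)
Definition coh_surj X Y (P : resolution X) (Q : resolution Y)
    (a : forall n, {linear rmod P n -> rmod Q n}) V i : Prop :=
  forall w : {linear rmod P i -> V}, is_cocycle w ->
  exists2 u : {linear rmod Q i -> V}, is_cocycle u & is_coboundary (w \- (u \o a i)).

Definition coh_inj X Y (P : resolution X) (Q : resolution Y)
    (a : forall n, {linear rmod P n -> rmod Q n}) V i : Prop :=
  forall u : {linear rmod Q i -> V}, is_cocycle u ->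
  is_coboundary (u \o a i) -> is_coboundary u.

Section Comparison.
Variables (X Y : lmodType S) (h : {linear X -> Y}).
Variables (P P' : resolution X) (Q Q' : resolution Y).
Variables (a : forall n, {linear rmod P n -> rmod Q n})
  (a' : forall n, {linear rmod P' n -> rmod Q' n}).
Hypotheses (a_lifts : lifts h a) (a'_lifts : lifts h a').
Variables (V : lmodType S) (i : nat).

Let lifts_id Z (C : resolution Z) :
  lifts idfun (fun n => idfun : {linear rmod C n -> _}).
Proof. by []. Qed.

Let lifts_comp Z Z' Z'' (C : resolution Z) (C' : resolution Z')
    (C'' : resolution Z'') k k' b b' :
  @lifts Z Z' C C' k b -> @lifts Z' Z'' C' C'' k' b' ->
  lifts (k' \o k) (fun n => b' n \o b n).
Proof.
by move=> [b0 bS] [b'0 b'S]; split=> [|n] x /=; rewrite ?b'0 ?b0 ?b'S ?bS.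
Qed.

(** With u found for [w p], the class of w comes from [u q]: the difference w - u q a' is (w - w p
    p') + (w p - u a) p' + (u a p' - u q a'). The outer terms are coboundaries by homotopy, the
    middle one by the choice of u. *)
Lemma coh_surj_comparison : coh_surj a V i -> coh_surj a' V i.
Proof.
move=> a_surj w w0.
have [p p_lifts] := lifts_ex P P' idfun; have [p' p'_lifts] := lifts_ex P' P idfun.
have [q q_lifts] := lifts_ex Q' Q idfun.
have [x|u u0 uE] := a_surj (w \o p i); first by rewrite /= -(p_lifts.2) w0.
exists (u \o q i) => [x|]; first by rewrite /= -(q_lifts.2) u0.
have wpp' := lifts_homotopic (lifts_id P') (lifts_comp p'_lifts p_lifts) w0
  (w := w \- (w \o (p i \o p' i))) (frefl _).
have uap' := lifts_homotopic (lifts_comp p'_lifts a_lifts)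
  (lifts_comp a'_lifts q_lifts) u0
  (w := (u \o (a i \o p' i)) \- (u \o (q i \o a' i))) (frefl _).
have wpuap' := is_coboundary_comp p'_lifts
  (w := ((w \o p i) \- (u \o a i)) \o p' i) (frefl _) uE.
apply: (is_coboundaryD _ wpp' (is_coboundaryD
  (w := ((w \o p i \- (u \o a i)) \o p' i) \+ _) (frefl _) wpuap' uap')) => x /=.
by rewrite !addrA !subrK.
Qed.

(** Up to coboundaries u is u q' q, and u q' a is u a' p, which is a coboundary. Injectivity for [a]
    then makes u q' a coboundary. *)
Lemma coh_inj_comparison : coh_inj a V i -> coh_inj a' V i.
Proof.
move=> a_inj u u0 ua'.
have [p p_lifts] := lifts_ex P P' idfun.
have [q q_lifts] := lifts_ex Q' Q idfun; have [q' q'_lifts] := lifts_ex Q Q' idfun.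
have uqq' := lifts_homotopic (lifts_id Q') (lifts_comp q_lifts q'_lifts) u0
  (w := u \- (u \o (q' i \o q i))) (frefl _).
have uq'a := lifts_homotopic (lifts_comp a_lifts q'_lifts)
  (lifts_comp p_lifts a'_lifts) u0
  (w := (u \o (q' i \o a i)) \- (u \o (a' i \o p i))) (frefl _).
have ua'p := is_coboundary_comp p_lifts
  (w := (u \o a' i) \o p i) (frefl _) ua'.
have uq' : is_coboundary (u \o q' i).
  apply: a_inj => [x|]; first by rewrite /= -(q'_lifts.2) u0.
  by apply: (is_coboundaryD _ uq'a ua'p) => x /=; rewrite subrK.
have uq'q := is_coboundary_comp q_lifts (w := (u \o q' i) \o q i) (frefl _) uq'.
by apply: (is_coboundaryD _ uqq' uq'q) => x /=; rewrite subrK.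
Qed.

End Comparison.
End Resolutions.

Arguments rd {S X} r n.
Arguments raug {S X} r.
Arguments rmod_proj {S X} r n.
Arguments raug_surj {S X} r.
Arguments raug_exact {S X} r.
Arguments rd_exact {S X} r n.
Arguments rdK {S X} P n x.
Arguments raugK {S X} P x.

(** * The canonical free resolution, and [Ext] in terms of cocycles *)

Section CanonicalResolution.
Context {S : nzRingType}.
Implicit Types X Y V : lmodType S.

Lemma augU X (x : X) : aug << x >> = x.
Proof. exact: fgliftU. Qed.

Definition free_resolution X : resolution X := {|
  rmod := fun n => res n X;
  rd := fun n => res_d n X;
  raug := @aug S X;
  rmod_proj := fun n => @freeg_projective S (syz n X);
  raug_surj := @aug_surj S X;
  raug_exact := fun x => iff_sym (res_exact (n := 0) x);
  rd_exact := fun n x => iff_sym (res_exact (n := n.+1) x) |}.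

Lemma res_map_lifts X Y (h : {linear X -> Y}) :
  lifts (P := free_resolution X) (Q := free_resolution Y) h (fun n => res_map n h).
Proof. by split=> [x|n x] /=; [exact: aug_free_map | exact: res_d_map]. Qed.

Lemma cocycleE X V n (u : linHom (res n X) V) :
  (u \in @cocycle_pred _ (ext_d X V) n) <-> is_cocycle (P := free_resolution X) u.
Proof.
split=> [/eqP u0 x|u0]; last by apply/eqP/Hom_ext.
exact: (congr1 (fun k : linHom _ _ => (k : {linear _ -> _}) x) u0).
Qed.

Lemma coboundaryE X V n (u : linHom (res n X) V) :
  coboundary (ext_d X V) u <-> is_coboundary (P := free_resolution X) u.
Proof.
case: n u => [|n] u /=.
  by split=> [-> //|u0]; apply: Hom_ext.
by split=> -[b bE]; exists b; [move=> x; rewrite bE | exact: Hom_ext].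
Qed.

Lemma Ext_eq0 n X V : (forall e : Ext n X V, e = 0) <->
  (forall u, is_cocycle (P := free_resolution X) u ->
             is_coboundary (P := free_resolution X) (V := V) (i := n) u).
Proof.
split=> [E0 u /cocycleE uP|Ecob e].
  exact/coboundaryE/(coh_class_eq0 (Cocycle uP)).1/E0.
have [[c cP] ->] := coh_classP e.
exact/coh_class_eq0/coboundaryE/Ecob/cocycleE.
Qed.

Lemma is_coboundary_eq X (P : resolution X) V i (u v : {linear rmod P i -> V}) :
  u =1 v -> is_coboundary u -> is_coboundary v.
Proof. by move=> uv; have -> : v = u by apply: Hom_ext => x; rewrite uv. Qed.

(** An additive map is bijective when it is onto with zero kernel; both properties are read on
    representatives, and the inverse is obtained by choice. *)
Lemma Ext_map_bijective n X Y (h : {linear X -> Y}) V :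
  bijective (Ext_map n h V) <->
  coh_surj (P := free_resolution X) (Q := free_resolution Y)
    (fun n => res_map n h) V n /\
  coh_inj (P := free_resolution X) (Q := free_resolution Y)
    (fun n => res_map n h) V n.
Proof.
have eE (c : cocycle (ext_d Y V) n) :
  Ext_map n h V (coh_class c) =
    coh_class (cocycle_map (f := fun n => Hom_map (res_map n h) V : {additive _ -> _})
      (@ext_map_comm S X Y h V) c).
  exact: coh_map_class.
have class_eq Z (c c' : cocycle (ext_d Z V) n) : coh_class c = coh_class c' <->
    is_coboundary (P := free_resolution Z) (val c \- val c' : {linear _ -> _}).
  split=> [cc'|cc'].
    have /coh_class_eq0/coboundaryE : coh_class (c - c') = 0.
      by rewrite raddfB /= cc' subrr.
    exact: is_coboundary_eq.
  apply/eqP; rewrite -subr_eq0 -raddfB; apply/eqP/coh_class_eq0/coboundaryE.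
  exact: is_coboundary_eq cc'.
split=> [[k hK kK]|[h_surj h_inj]].
  split=> [w /cocycleE wP|u /cocycleE uP ua].
    have [[u uP] uE] := coh_classP (k (coh_class (Cocycle wP))).
    exists u; first exact/cocycleE.
    by have := kK (coh_class (Cocycle wP)); rewrite uE eE => /esym /class_eq.
  apply/coboundaryE/(coh_class_eq0 (Cocycle uP)).1/(can_inj hK).
  rewrite -(raddf0 (@coh_class _ (ext_d Y V) n)) !eE; apply/class_eq.
  apply: is_coboundary_eq ua => x /=; by rewrite subr0.
pose h_add := GRing.isZmodMorphism.Build _ _ _ (@Ext_map_additive S n X Y h V).
pose E : {additive Ext n Y V -> Ext n X V} := HB.pack (Ext_map n h V) h_add.
have h_ker e : Ext_map n h V e = 0 -> e = 0.
  have [[u uP] ->] := coh_classP e.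
  rewrite eE -(raddf0 (@coh_class _ (ext_d X V) n)) => /class_eq ua.
  apply/coh_class_eq0/coboundaryE/h_inj; first exact/cocycleE.
  by apply: is_coboundary_eq ua => x /=; rewrite subr0.
have E_inj : injective E.
  move=> e e' /eqP; rewrite -subr_eq0 -raddfB => /eqP /h_ker /eqP.
  by rewrite subr_eq0 => /eqP.
have E_surj e : exists e', E e' = e.
  have [[w wP] ->] := coh_classP e.
  have [u /cocycleE uP uw] := h_surj w ((cocycleE w).1 wP).
  exists (coh_class (Cocycle uP)); rewrite /= eE; apply/esym/class_eq.
  exact: is_coboundary_eq uw.
exists (fun e => projT1 (cid (E_surj e))) => e.
  by apply: E_inj; case: cid.
by case: cid.
Qed.

(** Cocycles of degree 0 are the maps that factor through the augmentation, and the only coboundary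
    of degree 0 is zero, so H^0 is the group of homomorphisms. *)
Lemma Hom_map_surjective X Y (h : {linear X -> Y}) V :
  surjective (Hom_map h V) <->
  coh_surj (P := free_resolution X) (Q := free_resolution Y) (fun n => res_map n h) V 0.
Proof.
have factor Z (w : {linear res 0 Z -> V}) : is_cocycle (P := free_resolution Z) w ->
    exists k : {linear Z -> V}, forall x, w x = k (aug x).
  move=> w0; have w_ker x : aug x = 0 -> w x = 0.
    by move/(res_exact (n := 0) _).2 => [y ->]; apply: w0.
  (* The factorisation evaluates [w] on generators. It is linear because the failure of [<< z >>] to
     be linear in z lies in the kernel of [aug]. *)
  have k_lin : linear (fun z : Z => w << z >>).
    move=> a z z'; apply/eqP; rewrite -subr_eq0 -linearP -raddfB; apply/eqP/w_ker.
    by rewrite raddfB /= linearP /= !augU subrr.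
  exists (linmap k_lin) => x; apply/eqP; rewrite -subr_eq0 /= -raddfB.
  by apply/eqP/w_ker; rewrite raddfB /= augU subrr.
have cocycle_aug (Z : lmodType S) (k : {linear Z -> V}) :
    is_cocycle (P := free_resolution Z) (k \o @aug S Z : {linear res 0 Z -> V}).
  by move=> x /=; rewrite (raugK (free_resolution Z)) raddf0.
split=> [h_surj w /factor [k kE]|h_surj k].
  have [k' k'E] := h_surj k; exists (k' \o @aug S Y : {linear res 0 Y -> V}) => // x /=.
  by rewrite aug_free_map kE -k'E subrr.
have [u /factor [k' k'E] uE] := h_surj _ (cocycle_aug X k).
exists k'; apply: Hom_ext => x; have /= /eqP := uE << x >>.
by rewrite k'E aug_free_map !augU subr_eq0 => /eqP <-.
Qed.

End CanonicalResolution.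

(** * Tensor products *)

Section Tensors.
Context {R : comNzRingType} {B A : algType R}.
Variable M : bimodType B A.
Implicit Types X Y Z : lmodType A.

Lemma ract0r (m : M) : ract m 0 = 0.
Proof. by apply: (addrI (ract m 0)); rewrite -ractDr !addr0. Qed.

Lemma ract0l a : ract (0 : M) a = 0.
Proof. by apply: (addrI (ract 0 a)); rewrite -ractDl !addr0. Qed.

Lemma fin_gen_left : fin_gen R (restr M) -> fin_gen B M.
Proof.
move=> [s sP]; exists s => v; have [c cE] := sP v.
by exists (fun i => (c i)%:A); rewrite [LHS]cE.
Qed.

Lemma fin_gen_right : fin_gen R (restr M) -> fin_gen A^c (right_mod M).
Proof.
move=> [s sP]; exists s => v; have [c cE] := sP v.
exists (fun i => (c i)%:A); rewrite [LHS]cE; apply: eq_bigr => i _.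
exact/esym/ractC.
Qed.

Definition balanced X (V : lmodType B) (h : M -> X -> V) : Prop :=
  [/\ forall x, {morph h^~ x : m m' / m + m'},
      forall m, {morph h m : x x' / x + x'},
      forall m a x, h (ract m a) x = h m (a *: x) &
      forall b m x, h (b *: m) x = b *: h m x].

Lemma tensor_linear_ext X (V : lmodType B) (h k : {linear tensor M X -> V}) :
  (forall m x, h (tens m x) = k (tens m x)) -> h =1 k.
Proof. exact: tensor_ext. Qed.

Section BalancedLift.
Variables (X : lmodType A) (V : lmodType B) (h : M -> X -> V).
Hypothesis h_bal : balanced h.

Let lift_additive : zmod_morphism (tensor_lift h).
Proof. by case: h_bal => hDl hDr hbal _; apply: tensor_lift_additive. Qed.

Let lift0 : {additive tensor M X -> V} := HB.pack (tensor_lift h)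
  (GRing.isZmodMorphism.Build _ _ _ lift_additive).

Let lift0U m x : tensor_lift h (tens m x) = h m x.
Proof. by case: h_bal => hDl hDr hbal _; apply: tensor_liftU. Qed.

Lemma balanced_lift :
  {k : {linear tensor M X -> V} | forall m x, k (tens m x) = h m x}.
Proof.
have lift_linear : linear (tensor_lift h).
  move=> b s t; rewrite [LHS](raddfD lift0); congr (_ + _).
  apply: (@tensor_ext _ _ _ _ _ _ (lift0 \o ( *:%R b)) (( *:%R b) \o lift0)) => m x /=.
  by rewrite tensZl !lift0U; case: h_bal => _ _ _ ->.
by exists (linmap lift_linear) => m x; apply: lift0U.
Qed.

End BalancedLift.

Fact tens_map_balanced X Y (k : {linear X -> Y}) :
  balanced (fun m x => tens m (k x)).
Proof.
split=> [x m m'|m x x'|m a x|b m x]; rewrite ?tensDl ?raddfD ?tensDr ?tensZl //=.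
by rewrite tens_bal linearZ.
Qed.

(* Built from an opaque existence proof so that simplification does not unfold it. *)
Definition tens_map X Y (k : {linear X -> Y}) : {linear tensor M X -> tensor M Y} :=
  sval (balanced_lift (tens_map_balanced k)).

Lemma tens_mapE X Y (k : {linear X -> Y}) m x :
  tens_map k (tens m x) = tens m (k x).
Proof. exact: (svalP (balanced_lift (tens_map_balanced k))). Qed.

(* Finite dual basis of the right module M: the functionals act as maps
   M (x) X -> X, natural in X, that determine every element of M (x) X. *)
Lemma tensor_dual_basis :
  fin_gen A^c (right_mod M) -> projective A^c (right_mod M) ->
  exists n (s : 'I_n -> M) (b : forall X, 'I_n -> {additive tensor M X -> X}),
    (forall X t, t = \sum_i tens (s i) (b X i t)) /\
    (forall X Y (k : {linear X -> Y}) i t, b Y i (tens_map k t) = k (b X i t)).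
Proof.
move=> M_fg M_proj; have [n [s [c cE]]] := dual_basis M_fg M_proj.
(* Read with values in [A] instead of [A^c], the functionals turn the right action into right
   multiplication. *)
pose c' i (m : M) : A := c i m.
have c'D i : {morph c' i : m m' / m + m'} by move=> m m'; apply: raddfD.
have c'Z i m a : c' i (ract m a) = c' i m * a.
  exact: (linearZ_LR (c i) (a : A^c) (m : right_mod M)).
pose h X i (m : M) (x : X) := c' i m *: x.
have hDl X i x : {morph (h X i)^~ x : m m' / m + m'}.
  by move=> m m'; rewrite /h c'D scalerDl.
have hDr X i m : {morph h X i m : x x' / x + x'} by move=> x x'; apply: scalerDr.
have hbal X i m a x : h X i (ract m a) x = h X i m (a *: x).
  by rewrite /h c'Z scalerA.
have lift X i : {b : {additive tensor M X -> X} |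
    forall m x, b (tens m x) = c' i m *: x}.
  have h_add := tensor_lift_additive (hDl X i) (hDr X i) (hbal X i).
  pose b : {additive tensor M X -> X} :=
    HB.pack (tensor_lift (h X i)) (GRing.isZmodMorphism.Build _ _ _ h_add).
  exists b => m x.
  exact: (tensor_liftU (hDl X i) (hDr X i) (hbal X i)).
pose b X i := sval (lift X i).
have bE X i : forall m x, b X i (tens m x) = c' i m *: x := svalP (lift X i).
exists n, s, b.
split=> [X t|X Y k i t].
  pose sum t := \sum_i tens (s i) (b X i t).
  have sum_add : zmod_morphism sum.
    move=> u v; rewrite -sumrB; apply: eq_bigr => i _; rewrite raddfB.
    apply: (addIr (tens (s i) (b X i v))).
    by rewrite -tensDr !subrK.
  apply: (@tensor_ext _ _ _ _ _ _ idfun (HB.pack sum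
    (GRing.isZmodMorphism.Build _ _ _ sum_add) : {additive _ -> _})) => m x /=.
  rewrite {1}(cE m).
  rewrite (big_morph (fun m => tens m x) (fun m m' => tensDl m m' x) (tens0l M x)).
  by apply: eq_bigr => i _; rewrite bE -tens_bal.
apply: (@tensor_ext _ _ _ _ _ _ (b Y i \o tens_map k) (k \o b X i)) => m x /=.
by rewrite tens_mapE !bE linearZ.
Qed.

Section Flat.
Hypotheses (M_fg : fin_gen A^c (right_mod M)) (M_proj : projective A^c (right_mod M)).

Lemma tens_map_surj X Y (k : {linear X -> Y}) :
  surjective k -> surjective (tens_map k).
Proof.
have [n [s [b [bE _]]]] := tensor_dual_basis M_fg M_proj => k_surj t.
exists (\sum_i tens (s i) (projT1 (cid (k_surj (b Y i t))))).
rewrite raddf_sum [RHS]bE; apply: eq_bigr => i _ /=.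
by rewrite tens_mapE; case: cid => x /= ->.
Qed.

(** Naturality of the dual basis reduces exactness to each coordinate: if [t] is killed, its
    coordinates are killed by [l], hence come from [X]. *)
Lemma tens_map_exact X Y Z (k : {linear X -> Y}) (l : {linear Y -> Z}) :
  (forall y, l y = 0 <-> exists x, y = k x) ->
  forall t, tens_map l t = 0 <-> exists s, t = tens_map k s.
Proof.
have [n [s [b [bE b_nat]]]] := tensor_dual_basis M_fg M_proj => kl t.
split=> [t0|[u ->]].
  have lb i : exists x, b Y i t = k x by apply/kl; rewrite -b_nat t0 raddf0.
  exists (\sum_i tens (s i) (projT1 (cid (lb i)))).
  rewrite raddf_sum [LHS]bE; apply: eq_bigr => i _ /=.
  by rewrite tens_mapE; case: cid => x /= ->.
apply: (@tensor_ext _ _ _ _ _ _ (tens_map l \o tens_map k) \0) => m x /=.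
by rewrite !tens_mapE (_ : l (k x) = 0) ?tens0r //; apply/kl; exists x.
Qed.

End Flat.

Section BimoduleHom.
Variable U : lmodType B.

(** Hom_B(M, U) becomes a left A-module through the right action on M; as a functor of U it is right
    adjoint to tensoring with M. *)
Definition bimod_hom : Type := linHom M U.
HB.instance Definition _ := GRing.Zmodule.on bimod_hom.

Definition bimod_ev (k : bimod_hom) : {linear M -> U} := k.

Fact bimod_hom_scale_linear a (k : bimod_hom) :
  linear (fun m => bimod_ev k (ract m a)).
Proof. by move=> b m m'; rewrite ractDl ractZ linearP. Qed.

Definition bimod_hom_scale a k : bimod_hom := linmap (bimod_hom_scale_linear a k).

Fact bimod_hom_scaleA a b k :
  bimod_hom_scale a (bimod_hom_scale b k) = bimod_hom_scale (a * b) k.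
Proof. by apply: Hom_ext => m /=; rewrite ractA. Qed.

Fact bimod_hom_scale1 : left_id 1 bimod_hom_scale.
Proof. by move=> k; apply: Hom_ext => m /=; rewrite ract1. Qed.

Fact bimod_hom_scaleDr : right_distributive bimod_hom_scale +%R.
Proof. by move=> a k l; apply: Hom_ext. Qed.

Fact bimod_hom_scaleDl k : {morph bimod_hom_scale^~ k : a b / a + b}.
Proof. by move=> a b; apply: Hom_ext => m /=; rewrite ractDr raddfD. Qed.

HB.instance Definition _ := GRing.Zmodule_isLmodule.Build A bimod_hom
  bimod_hom_scaleA bimod_hom_scale1 bimod_hom_scaleDr bimod_hom_scaleDl.

End BimoduleHom.

(** By adjunction, lifting from M (x) X along [p] amounts to lifting from X along Hom_B(M, p), which
    is onto because M is projective over B. *)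
Lemma tensor_projective X :
  projective B M -> projective A X -> projective B (tensor M X).
Proof.
move=> M_proj X_proj U V p h p_surj.
have pM_lin : linear (fun k : bimod_hom U => p \o bimod_ev k : bimod_hom V).
  by move=> a k l; apply: Hom_ext => m /=; rewrite linearD.
have hX_mlin x : linear (fun m => h (tens m x)).
  by move=> b m m'; rewrite tensDl -tensZl linearP.
have hX_lin : linear (fun x => linmap (hX_mlin x) : bimod_hom V).
  move=> a x x'; apply: Hom_ext => m /=.
  by rewrite tensDr -tens_bal raddfD.
have pM_surj : surjective (linmap pM_lin).
  move=> k; have [l lE] := M_proj _ _ p (bimod_ev k) p_surj.
  by exists l; apply: Hom_ext.
have [k kE] := X_proj _ _ (linmap pM_lin) (linmap hX_lin) pM_surj.
have k_bal : balanced (fun m x => bimod_ev (k x) m).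
  split=> [x m m'|m x x'|m a x|b m x]; rewrite ?linearD ?linearZ //=.
have [l lE] := balanced_lift k_bal.
exists l; apply: (tensor_linear_ext (h := p \o l)) => m x /=; rewrite lE.
exact: (congr1 (fun l : bimod_hom V => bimod_ev l m) (kE x)).
Qed.

End Tensors.

(** * Corners of a ring *)

Section Corners.
Context {S A : nzRingType}.

(* A is identified with a corner e S e, where e is the image of 1. *)
Record corner_map := CornerMap {
  corner_emb :> {additive A -> S};
  corner_embM : forall a b, corner_emb (a * b) = corner_emb a * corner_emb b }.

Variable iota : corner_map.
Implicit Types F G H : lmodType S.

Section Module.
Variable F : lmodType S.

(** The corner is e F for the idempotent e = [iota 1], cut out as the fixed points of e. *)
Definition corner_pred : {pred F} := [pred z | iota 1 *: z == z].

Fact corner_zmod : zmod_closed corner_pred.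
Proof.
split=> [|z w]; rewrite !inE ?scaler0 // => /eqP hz /eqP hw.
by rewrite scalerBr hz hw.
Qed.

HB.instance Definition _ := GRing.isZmodClosed.Build F corner_pred corner_zmod.

Record corner : Type :=
  Corner { corner_val :> F; _ : corner_val \in corner_pred }.

HB.instance Definition _ := [isSub for corner_val].
HB.instance Definition _ := [Choice of corner by <:].
HB.instance Definition _ := [SubChoice_isSubZmodule of corner by <:].

Fact corner_scale_subproof a (z : F) : iota a *: z \in corner_pred.
Proof. by rewrite inE scalerA -corner_embM mul1r. Qed.

Definition corner_scale a (z : corner) : corner :=
  Corner (corner_scale_subproof a (val z)).

Lemma corner_valP (z : corner) : iota 1 *: val z = val z.
Proof. by case: z => z /= /eqP. Qed.

Fact corner_scaleA a b z : corner_scale a (corner_scale b z) = corner_scale (a * b) z.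
Proof. by apply: val_inj; rewrite /= scalerA corner_embM. Qed.

Fact corner_scale1 : left_id 1 corner_scale.
Proof. by move=> z; apply: val_inj; rewrite /= corner_valP. Qed.

Fact corner_scaleDr : right_distributive corner_scale +%R.
Proof. by move=> a z w; apply: val_inj; rewrite /= scalerDr. Qed.

Fact corner_scaleDl z : {morph corner_scale^~ z : a b / a + b}.
Proof. by move=> a b; apply: val_inj; rewrite /= raddfD scalerDl. Qed.

HB.instance Definition _ := GRing.Zmodule_isLmodule.Build A corner
  corner_scaleA corner_scale1 corner_scaleDr corner_scaleDl.

Definition corner_proj (z : F) : corner := Corner (corner_scale_subproof 1 z).

Lemma corner_projK (z : corner) : corner_proj (val z) = z.
Proof. by apply: val_inj; rewrite /= corner_valP. Qed.

Lemma corner_projB : {morph corner_proj : z w / z - w}.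
Proof. by move=> z w; apply: val_inj; rewrite /= scalerBr. Qed.

End Module.

Section Functor.
Variables (F G : lmodType S) (k : {linear F -> G}).

Fact corner_fun_subproof (z : corner F) : k (val z) \in @corner_pred G.
Proof. by rewrite inE -linearZ_LR corner_valP. Qed.

Fact corner_fun_linear : linear (fun z => Corner (corner_fun_subproof z)).
Proof. by move=> a z w; apply: val_inj; rewrite /= raddfD /= linearZ_LR. Qed.

Definition corner_fun : {linear corner F -> corner G} := linmap corner_fun_linear.

End Functor.

Section Coinduction.
Variable U : lmodType A.

Local Notation eS := (corner S^o).

Fact rmul_linear (l : S) : linear (fun x : S^o => (x : S) * l : S^o).
Proof. by move=> a x y; rewrite mulrDl /GRing.scale /= mulrA. Qed.

Definition rmul (l : S) : {linear S^o -> S^o} := linmap (rmul_linear l).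

(** Hom_A(e S, U), on which S acts through right multiplication on e S: the right adjoint of the
    functor taking F to e F. *)
Definition coind : Type := linHom eS U.
HB.instance Definition _ := GRing.Zmodule.on coind.

Definition coind_ev (k : coind) : {linear eS -> U} := k.

Definition coind_scale (l : S) (k : coind) : coind :=
  coind_ev k \o corner_fun (rmul l).

Lemma coind_ext (k k' : coind) : coind_ev k =1 coind_ev k' -> k = k'.
Proof. exact: Hom_ext. Qed.

Fact coind_scaleA a b k : coind_scale a (coind_scale b k) = coind_scale (a * b) k.
Proof.
apply: coind_ext => x /=; congr (coind_ev k _).
by apply: val_inj; rewrite /= mulrA.
Qed.

Fact coind_scale1 : left_id 1 coind_scale.
Proof.
move=> k; apply: coind_ext => x /=; congr (coind_ev k _).
by apply: val_inj; rewrite /= mulr1.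
Qed.

Fact coind_scaleDr : right_distributive coind_scale +%R.
Proof. by move=> a k l; apply: coind_ext. Qed.

Fact coind_scaleDl k : {morph coind_scale^~ k : a b / a + b}.
Proof.
move=> a b; apply: coind_ext => x /=; rewrite -raddfD; congr (coind_ev k _).
by apply: val_inj; rewrite /= mulrDr.
Qed.

HB.instance Definition _ := GRing.Zmodule_isLmodule.Build S coind
  coind_scaleA coind_scale1 coind_scaleDr coind_scaleDl.

Lemma coind_evD (k l : coind) x : coind_ev (k + l) x = coind_ev k x + coind_ev l x.
Proof. by []. Qed.

Lemma coind_scaleE l (k : coind) x :
  coind_ev (l *: k) x = coind_ev k (corner_fun (rmul l) x).
Proof. by []. Qed.

Definition corner_one : eS := Corner (corner_scale_subproof 1 (1 : S^o)).

(** One direction of the adjunction: evaluation at e = [corner_one] turns an S-linear map into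
    Hom_A(e S, U) into an A-linear map on e F. *)
Lemma coind_unit_linear F (k : {linear F -> coind}) :
  linear (fun z : corner F => coind_ev (k (val z)) corner_one).
Proof.
move=> a z w; have -> : val (a *: z + w) = iota a *: val z + val w by [].
rewrite linearP coind_evD coind_scaleE -linearZ_LR; congr (coind_ev _ _ + _).
by apply: val_inj; rewrite /= /GRing.scale /= !mulr1 -!corner_embM mul1r mulr1.
Qed.

End Coinduction.

Local Notation eS := (corner S^o).

(** Again by adjunction: a lifting problem on e F becomes one on F, along a map of coinduced modules
    that is onto because e S is projective over A. The adjoint of [h] sends z to the map taking x to
    h (x z). *)
Lemma corner_projective F :
  projective A eS -> projective S F -> projective A (corner F).
Proof.
move=> eS_proj F_proj U V p h p_surj.
have act_lin (z : F) : linear (fun x : S^o => (x : S) *: z).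
  by move=> a x y; rewrite scalerDl scalerA.
have hF_lin : linear (fun z : F => h \o corner_fun (linmap (act_lin z)) : coind V).
  move=> a z w; apply: coind_ext => x /=; rewrite -raddfD; congr (h _).
  by apply: val_inj; rewrite /= scalerDr scalerA.
have pS_lin : linear (fun k : coind U => p \o coind_ev k : coind V).
  by move=> a k l; apply: coind_ext => x /=; rewrite raddfD.
have pS_surj : surjective (linmap pS_lin).
  move=> k; have [l lE] := eS_proj _ _ p (coind_ev k) p_surj.
  by exists l; apply: coind_ext.
have [k kE] := F_proj _ _ (linmap pS_lin) (linmap hF_lin) pS_surj.
exists (linmap (coind_unit_linear k)) => z /=.
have := congr1 (fun l : coind V => coind_ev l corner_one) (kE (val z)) => /= ->.
congr (h _); apply: val_inj; rewrite -[RHS]corner_valP; congr (_ *: _).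
exact: mulr1.
Qed.

Lemma corner_exact F G H (k : {linear F -> G}) (l : {linear G -> H}) :
  (forall y, l y = 0 <-> exists x, y = k x) ->
  forall y, corner_fun l y = 0 <-> exists x, y = corner_fun k x.
Proof.
move=> kl y; split=> [/(congr1 val)/=/kl[x xE]|[x ->]].
  (* A preimage in [F] is brought into the corner by multiplying it by e. *)
  exists (corner_proj x); apply: val_inj; rewrite /= linearZ_LR -xE.
  exact/esym/corner_valP.
by apply: val_inj; apply/kl; exists (val x).
Qed.

Lemma corner_surj F G (k : {linear F -> G}) :
  surjective k -> surjective (corner_fun k).
Proof.
move=> k_surj y; have [x xE] := k_surj (val y).
exists (corner_proj x); apply: val_inj; rewrite /= linearZ_LR xE.
exact: corner_valP.
Qed.

End Corners.

Arguments corner_one {S A iota}.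

(** * Peirce decomposition of the Morita ring *)

(* A ring S with the Peirce decomposition of the Morita ring: elements of S are
   matrices (a n; m b), the coefficients of s being coef11 s, coef12 s, coef21 s
   and coef22 s.  The record is invariant under exchanging A and B, which is why
   it is used instead of [morita M N]. *)
Record peirce (S : nzRingType) (R : comNzRingType) (A B : algType R)
    (M : bimodType B A) (N : bimodType A B) := Peirce {
  emb11 : corner_map (S := S) (A := A);
  emb22 : corner_map (S := S) (A := B);
  emb12 : {additive N -> S};
  emb21 : {additive M -> S};
  coef11 : {additive S -> A};
  coef12 : {additive S -> N};
  coef21 : {additive S -> M};
  coef22 : {additive S -> B};
  emb12_scale : forall a n, emb12 (a *: n) = emb11 a * emb12 n;
  emb12_ract : forall n b, emb12 (ract n b) = emb12 n * emb22 b;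
  emb21_scale : forall b m, emb21 (b *: m) = emb22 b * emb21 m;
  emb21_ract : forall m a, emb21 (ract m a) = emb21 m * emb11 a;
  row1E : forall s, emb11 1 * s = emb11 (coef11 s) + emb12 (coef12 s);
  row2E : forall s, emb22 1 * s = emb22 (coef22 s) + emb21 (coef21 s);
  coef11M : forall a s, coef11 (emb11 a * s) = a * coef11 s;
  coef12M : forall a s, coef12 (emb11 a * s) = a *: coef12 s;
  coef21M : forall b s, coef21 (emb22 b * s) = b *: coef21 s;
  coef22M : forall b s, coef22 (emb22 b * s) = b * coef22 s;
  coef12_row : forall n s, coef12 (emb12 n * s) = ract n (coef22 s);
  coef21_row : forall m s, coef21 (emb21 m * s) = ract m (coef11 s) }.

Definition peirce_swap S R A B M N (p : @peirce S R A B M N) : peirce S N M :=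
  Peirce (emb21_scale p) (emb21_ract p) (emb12_scale p) (emb12_ract p)
    (row2E p) (row1E p) (coef22M p) (coef21M p) (coef12M p) (coef11M p)
    (coef21_row p) (coef12_row p).

(** For fixed [x] the expression is balanced in [n] and [m], so it factors through N (x) M = 0. *)
Lemma tens_tens0 (R : comNzRingType) (A B : algType R) (M : bimodType B A)
    (N : bimodType A B) (X : lmodType A) (Y : lmodType B)
    (f : {linear tensor M X -> Y}) (NM0 : forall t : tensor N M, t = 0) n m x :
  tens n (f (tens m x)) = 0 :> tensor N Y.
Proof.
apply: (@tensor_lift_eq0 _ _ _ N M _ (fun n m => tens n (f (tens m x)))) => //.
- by move=> m' n1 n2; rewrite tensDl.
- by move=> n' m1 m2; rewrite tensDl raddfD /= tensDr.
- by move=> n' b m'; rewrite tens_bal -linearZ_LR /= tensZl.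
Qed.

Section PeirceModules.
Context {S : nzRingType} {R : comNzRingType} {A B : algType R}.
Context {M : bimodType B A} {N : bimodType A B}.
Variable p : peirce S M N.
Implicit Types F G : lmodType S.

Local Notation corner1 := (corner (emb11 p)).
Local Notation corner2 := (corner (emb22 p)).

Section StructureMap.
Variable F : lmodType S.

Fact peirce_act_subproof n (y : corner2 F) :
  emb12 p n *: val y \in @corner_pred _ _ (emb11 p) F.
Proof. by rewrite inE scalerA -emb12_scale scale1r. Qed.

Definition peirce_act n (y : corner2 F) : corner1 F := Corner (peirce_act_subproof n y).

Fact peirce_act_balanced : balanced peirce_act.
Proof.
split=> [y n n'|n y y'|n b y|a n y]; apply: val_inj => /=.
- by rewrite raddfD scalerDl.
- by rewrite scalerDr.
- by rewrite emb12_ract -scalerA.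
- by rewrite emb12_scale -scalerA.
Qed.

(** The structure map g of the quadruple attached to F; the map f is obtained from
    [peirce_swap p]. *)
Definition peirce_map : {linear tensor N (corner2 F) -> corner1 F} :=
  sval (balanced_lift peirce_act_balanced).

Lemma peirce_mapE n y : val (peirce_map (tens n y)) = emb12 p n *: val y.
Proof. by rewrite (svalP (balanced_lift peirce_act_balanced)). Qed.

End StructureMap.

Lemma peirce_map_natural F G (k : {linear F -> G}) t :
  corner_fun (emb11 p) k (peirce_map F t) =
  peirce_map G (tens_map N (corner_fun (emb22 p) k) t).
Proof.
apply: (tensor_linear_ext (h := corner_fun (emb11 p) k \o peirce_map F)
  (k := peirce_map G \o tens_map N (corner_fun (emb22 p) k))) => n y /=.
rewrite tens_mapE; apply: val_inj; rewrite [RHS]peirce_mapE /= peirce_mapE.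
exact: linearZ_LR.
Qed.

Fact corner12_subproof n : (emb12 p n : S^o) \in @corner_pred _ _ (emb11 p) S^o.
Proof. by rewrite inE /GRing.scale /= -emb12_scale scale1r. Qed.

Definition corner12 n : corner1 S^o := Corner (corner12_subproof n).

(** As a left A-module e1 S is the sum of A and N. A lift is chosen on A by the value at e1 and on N
    by projectivity. *)
Lemma corner1_projective : projective A N -> projective A (corner1 S^o).
Proof.
move=> N_proj U V q h q_surj.
have hN_lin : linear (fun n => h (corner12 n)).
  move=> a n n'; rewrite -linearP; congr (h _); apply: val_inj => /=.
  by rewrite raddfD /= emb12_scale.
have [kN kNE] := N_proj _ _ q (linmap hN_lin) q_surj.
have [u uE] := q_surj (h corner_one).
have k_lin : linear (fun x : corner1 S^o =>
    coef11 p (val x) *: u + kN (coef12 p (val x))).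
  move=> a x y; rewrite !raddfD /= coef11M coef12M scalerDl linearZ_LR.
  by rewrite scalerA addrACA.
exists (linmap k_lin) => x /=; rewrite raddfD /= linearZ_LR uE kNE /=.
rewrite -linearZ_LR -raddfD; congr (h _); apply: val_inj => /=.
rewrite -[RHS]corner_valP [RHS]row1E; congr (_ + _).
by rewrite /GRing.scale /= mulr1 -corner_embM mulr1.
Qed.

End PeirceModules.

(** The second row of a matrix acting on a column; applied to [peirce_swap p] it also gives the
    first row. *)
Lemma peirce_row2 (S : nzRingType) (R : comNzRingType) (A B : algType R)
    (M : bimodType B A) (N : bimodType A B)
    (p : peirce S M N) (G : lmodType S) s (z : G) :
  corner_proj (emb22 p) (s *: z) =
  coef22 p s *: corner_proj (emb22 p) z +
  peirce_map (peirce_swap p) G (tens (coef21 p s) (corner_proj (emb11 p) z)).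
Proof.
apply: val_inj; transitivity (emb22 p (coef22 p s) *: (emb22 p 1 *: z) +
  emb21 p (coef21 p s) *: (emb11 p 1 *: z)).
  rewrite [LHS]scalerA row2E scalerDl.
  by rewrite !scalerA -corner_embM mulr1 -emb21_ract ract1.
apply: (congr2 +%R) => //.
exact: (esym (@peirce_mapE _ _ _ _ _ _ (peirce_swap p) G (coef21 p s)
  (corner_proj (emb11 p) z))).
Qed.

Section PeirceExtension.
Context {S : nzRingType} {R : comNzRingType} {A B : algType R}.
Context {M : bimodType B A} {N : bimodType A B}.
Variables (p : peirce S M N) (NM0 : forall t : tensor N M, t = 0).
Variables (K : choiceType) (U : lmodType A).

Local Notation F := ({freeg K / S} : lmodType S).
Local Notation e2 := (corner_proj (emb22 p)).

(* The structure map of the first row is a split monomorphism on free modules. *)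
Lemma peirce_map_extend (w : {linear tensor N (corner (emb22 p) F) -> U}) :
  exists u : {linear corner (emb11 p) F -> U}, forall t, u (peirce_map p F t) = w t.
Proof.
(* The map u is sought through its adjoint [L] from F to Hom_A(e1 S, U), which freeness allows to be
   prescribed on generators: s goes to w applied to its N-entry tensored with e2 x. *)
have phi_lin x : linear (fun s : corner (emb11 p) S^o =>
    w (tens (coef12 p (val s)) (e2 << x >>))).
  move=> a s t; rewrite raddfD /= coef12M tensDl -tensZl.
  exact: linearP.
pose phi x : coind (emb11 p) U := linmap (phi_lin x).
pose L : {linear F -> coind (emb11 p) U} := fglift phi.
(* The prescription persists for every z. On a multiple l x, the part of e2 (l x) that comes from M
   dies after tensoring with [n], since N (x) M = 0. *)
have LE z n : coind_ev (L z) (corner12 p n) = w (tens n (e2 z)).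
  have LU x : L << x >> = phi x := fgliftU phi x.
  have single l x : coind_ev (L (l *: << x >>)) (corner12 p n) =
      w (tens n (e2 (l *: << x >>))).
    rewrite linearZ_LR LU coind_scaleE /= coef12_row peirce_row2 tensDr raddfD.
    by rewrite (tens_tens0 (peirce_map (peirce_swap p) F)) // raddf0 addr0 tens_bal.
  pose W z := w (tens n (e2 z)).
  have W_add : zmod_morphism W.
    move=> y y'; rewrite /W corner_projB -raddfB; congr (w _).
    by apply: (addIr (tens n (e2 y'))); rewrite -tensDr !subrK.
  pose W' : {additive F -> U} := HB.pack W (GRing.isZmodMorphism.Build _ _ _ W_add).
  rewrite (freegE z) -/(W _) [RHS](raddf_sum W') raddf_sum.
  have ev_sum (I : Type) (r : seq I) (c : I -> coind (emb11 p) U) t :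
      coind_ev (\sum_(i <- r) c i) t = \sum_(i <- r) coind_ev (c i) t.
    by apply: (big_morph (fun k => coind_ev k t)).
  by rewrite ev_sum; apply: eq_bigr => x _; apply: single.
(* Evaluating at e1 on an element n y gives the value of L y at e1 n = n, which is the value of w on
   n (x) y. *)
exists (linmap (coind_unit_linear L)).
apply: (tensor_linear_ext
  (h := linmap (coind_unit_linear L) \o peirce_map p F)) => n y /=.
rewrite -[y in RHS]corner_projK -LE (@peirce_mapE _ _ _ _ _ _ p) linearZ_LR.
rewrite coind_scaleE; congr (coind_ev _ _); apply: val_inj.
by rewrite /= /GRing.scale /= mulr1 -emb12_scale scale1r.
Qed.

End PeirceExtension.

(** * The Morita ring as an instance of [peirce] *)

Section MoritaPeirce.
Context {R : comNzRingType} {A B : algType R}.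
Variables (M : bimodType B A) (N : bimodType A B).
Local Notation L := (morita M N).

Definition addmap (U V : zmodType) (h : U -> V) (h_add : zmod_morphism h) :
    {additive U -> V} := HB.pack h (GRing.isZmodMorphism.Build U V h h_add).

Let pairE (U V : zmodType) (u u' : U) (v v' : V) :
  u = u' -> v = v' -> (u, v) = (u', v').
Proof. by move=> -> ->. Qed.

Let emb11 a : L := ((a, 0), (0, 0)).
Let emb12 n : L := ((0, n), (0, 0)).
Let emb21 m : L := ((0, 0), (m, 0)).
Let emb22 b : L := ((0, 0), (0, b)).

Let emb11B : zmod_morphism emb11.
Proof. by move=> x y; do !apply: pairE => //=; rewrite subrr. Qed.
Let emb12B : zmod_morphism emb12.
Proof. by move=> x y; do !apply: pairE => //=; rewrite subrr. Qed.
Let emb21B : zmod_morphism emb21.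
Proof. by move=> x y; do !apply: pairE => //=; rewrite subrr. Qed.
Let emb22B : zmod_morphism emb22.
Proof. by move=> x y; do !apply: pairE => //=; rewrite subrr. Qed.

Let zeros := (mul0r, mulr0, scale0r, scaler0, (@ract0r R), (@ract0l R), addr0, add0r,
  mul1r, scale1r).

Let emb11M a b : emb11 (a * b) = emb11 a * emb11 b.
Proof. by rewrite /GRing.mul /= !zeros. Qed.
Let emb22M a b : emb22 (a * b) = emb22 a * emb22 b.
Proof. by rewrite /GRing.mul /= !zeros. Qed.

Let coef11 (l : L) := l.1.1.
Let coef12 (l : L) := l.1.2.
Let coef21 (l : L) := l.2.1.
Let coef22 (l : L) := l.2.2.

Let coef11B : zmod_morphism coef11. Proof. by []. Qed.
Let coef12B : zmod_morphism coef12. Proof. by []. Qed.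
Let coef21B : zmod_morphism coef21. Proof. by []. Qed.
Let coef22B : zmod_morphism coef22. Proof. by []. Qed.

(* Transparent, and headed by its constructor, so that swapping twice is the identity
   up to conversion. *)
Definition morita_peirce : peirce L M N.
Proof.
refine (@Peirce L R A B M N
  (@CornerMap _ _ (addmap emb11B) emb11M) (@CornerMap _ _ (addmap emb22B) emb22M)
  (addmap emb12B) (addmap emb21B)
  (addmap coef11B) (addmap coef12B) (addmap coef21B) (addmap coef22B)
  _ _ _ _ _ _ _ _ _ _ _ _) => //=.
1-4: by move=> u v; rewrite /GRing.mul /= !zeros.
1-2: by move=> [[a n] [m b]]; rewrite /GRing.mul /= !zeros;
  do !apply: pairE; rewrite /= zeros.
all: by move=> u [[a n] [m b]]; rewrite /GRing.mul /= ?zeros.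
Defined.

End MoritaPeirce.

(** * Cochains of the columns of the Morita ring *)

Section ChainMaps.
Context {S : nzRingType} {X Y : lmodType S}.
Variables (P : resolution X) (Q : resolution Y).
Variable a : forall n, {linear rmod P n -> rmod Q n}.
Hypothesis ad : forall n x, rd Q n (a n.+1 x) = a n (rd P n x).
Hypothesis a_extend : forall n (U : lmodType S) (w : {linear rmod P n -> U}),
  exists u : {linear rmod Q n -> U}, forall x, u (a n x) = w x.
Implicit Types V : lmodType S.

(** Surjectivity on cohomology in a strict form, with an equality of cochains instead of a
    congruence modulo coboundaries. *)
Definition cocycle_extend V i : Prop :=
  forall w : {linear rmod P i -> V}, is_cocycle w ->
  exists2 u : {linear rmod Q i -> V}, is_cocycle u & forall x, u (a i x) = w x.

(** Exactness, in degree i + 1, of the complex of cochains on [Q] that vanish on the image of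
    [a]. *)
Definition kernel_acyclic V i : Prop :=
  forall u : {linear rmod Q i.+1 -> V}, is_cocycle u -> (forall x, u (a i.+1 x) = 0) ->
  exists2 b : {linear rmod Q i -> V},
    forall x, u x = b (rd Q i x) & forall x, b (a i x) = 0.

(** If w and u a differ by the coboundary of b, an extension c of b along [a] corrects u by the
    coboundary of c. *)
Lemma coh_surjE V i : coh_surj a V i <-> cocycle_extend V i.
Proof.
split=> surj w /surj[u u0 uw]; last first.
  exists u => //; case: i w u u0 uw {surj} => [|i] w u u0 uw /=.
    by move=> x; rewrite uw subrr.
  by exists \0 => x /=; rewrite uw subrr.
case: i w u u0 uw {surj} => [|i] w u u0 /= uw.
  by exists u => // x; apply/esym/eqP; rewrite -subr_eq0 uw.
have [b bE] := uw; have [c cE] := a_extend b.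
exists (u \+ (c \o rd Q i)) => [x|x] /=; first by rewrite u0 rdK raddf0 addr0.
by rewrite ad cE -bE addrC subrK.
Qed.

(** The coordinates of w in a dual basis are extended one by one and recombined; the strict form of
    extension makes the recombination exact. *)
Lemma cocycle_extend_projective V i : fin_gen S V -> projective S V ->
  cocycle_extend S^o i -> cocycle_extend V i.
Proof.
move=> V_fg V_proj ext w w0; have [m [s [c cE]]] := dual_basis V_fg V_proj.
have ext_c j : exists u : {linear rmod Q i -> S^o},
    is_cocycle u /\ forall x, u (a i x) = c j (w x).
  have [x|u u0 uE] := ext (c j \o w); first by rewrite /= w0 raddf0.
  by exists u.
have [u uP] := choice ext_c.
have sum_lin : linear (fun y => \sum_j u j y *: s j).
  move=> r y y'; rewrite scaler_sumr -big_split; apply: eq_bigr => j _ /=.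
  by rewrite linearP scalerDl scalerA.
exists (linmap sum_lin) => x /=.
  by rewrite big1 // => j _; rewrite (uP j).1 scale0r.
by rewrite [RHS]cE; apply: eq_bigr => j _; rewrite (uP j).2.
Qed.

Lemma kernel_acyclic_projective V i : fin_gen S V -> projective S V ->
  kernel_acyclic S^o i -> kernel_acyclic V i.
Proof.
move=> V_fg V_proj acyc u u0 ua; have [m [s [c cE]]] := dual_basis V_fg V_proj.
have acyc_c j : exists b : {linear rmod Q i -> S^o},
    (forall x, c j (u x) = b (rd Q i x)) /\ forall x, b (a i x) = 0.
  have [x|x|b bE ba] := acyc (c j \o u); rewrite /= ?u0 ?ua ?raddf0 //.
  by exists b.
have [b bP] := choice acyc_c.
have sum_lin : linear (fun y => \sum_j b j y *: s j).
  move=> r y y'; rewrite scaler_sumr -big_split; apply: eq_bigr => j _ /=.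
  by rewrite linearP scalerDl scalerA.
exists (linmap sum_lin) => x /=.
  by rewrite [LHS]cE; apply: eq_bigr => j _; rewrite (bP j).1.
by rewrite big1 // => j _; rewrite (bP j).2 scale0r.
Qed.

(** Injectivity writes u as the coboundary of some b. As u vanishes on the image of [a], the
    restriction b a is a cocycle; subtracting a cocycle that extends it leaves the coboundary
    unchanged and makes b vanish there. *)
Lemma kernel_acyclicP V i :
  cocycle_extend V i -> coh_inj a V i.+1 -> kernel_acyclic V i.
Proof.
move=> ext inj u u0 ua; have [|b bE] := inj u u0.
  by exists \0 => x /=; rewrite ua.
have [x|b' b'0 b'E] := ext (b \o a i); first by rewrite /= -ad -bE ua.
exists (b \- b') => x /=; first by rewrite b'0 subr0 bE.
by rewrite b'E subrr.
Qed.

End ChainMaps.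

(** The comparison lemmas move the conditions from the canonical resolutions to any lift of [h]
    along which cochains extend. Surjectivity in degree 0 accounts for [Hom_map]; injectivity
    concerns positive degrees only. *)
Lemma Ext_map_conditions (S : nzRingType) (X Y V : lmodType S) (h : {linear X -> Y})
    (P : resolution X) (Q : resolution Y)
    (a : forall n, {linear rmod P n -> rmod Q n}) :
  lifts h a ->
  (forall n (U : lmodType S) (w : {linear rmod P n -> U}),
     exists u : {linear rmod Q n -> U}, forall x, u (a n x) = w x) ->
  surjective (Hom_map h V) /\ (forall i, (1 <= i)%N -> bijective (Ext_map i h V)) <->
  (forall i, cocycle_extend a V i) /\ (forall i, coh_inj a V i.+1).
Proof.
move=> a_lifts a_extend.
have surjE i := coh_surjE a_lifts.2 a_extend V i.
have h_lifts := res_map_lifts h.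
split=> [[Hom_surj Ext_bij]|[a_surj a_inj]].
  split=> i; last first.
    have [_ inj] := (Ext_map_bijective _ h V).1 (Ext_bij i.+1 isT).
    exact: (coh_inj_comparison h_lifts a_lifts inj).
  apply/surjE; case: i => [|i].
    exact: (coh_surj_comparison h_lifts a_lifts) ((Hom_map_surjective h V).1 Hom_surj).
  have [surj _] := (Ext_map_bijective _ h V).1 (Ext_bij i.+1 isT).
  exact: (coh_surj_comparison h_lifts a_lifts surj).
have surj i : coh_surj (P := free_resolution X) (Q := free_resolution Y)
    (fun n => res_map n h) V i.
  by apply: (coh_surj_comparison a_lifts h_lifts); apply/surjE.
split=> [|[//|i] _]; first exact/Hom_map_surjective/surj.
apply/Ext_map_bijective; split; first exact: surj.
exact: (coh_inj_comparison a_lifts h_lifts (a_inj i)).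
Qed.

Section TensorResolution.
Context {R : comNzRingType} {B A : algType R}.
Variables (M : bimodType B A) (X : lmodType A) (C : resolution X).
Hypotheses (M_fg : fin_gen A^c (right_mod M)) (MA_proj : projective A^c (right_mod M)).
Hypothesis BM_proj : projective B M.

Definition tens_resolution : resolution (tensor M X) := {|
  rmod := fun n => tensor M (rmod C n);
  rd := fun n => tens_map M (rd C n);
  raug := tens_map M (raug C);
  rmod_proj := fun n => tensor_projective BM_proj (rmod_proj C n);
  raug_surj := tens_map_surj M_fg MA_proj (raug_surj C);
  raug_exact := tens_map_exact M_fg MA_proj (raug_exact C);
  rd_exact := fun n => tens_map_exact M_fg MA_proj (rd_exact C n) |}.

End TensorResolution.

Section Columns.
Context {R : comNzRingType} {A B : algType R}.
Context {M : bimodType B A} {N : bimodType A B} {X : lmodType A} {Y : lmodType B}.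
Hypotheses (M_fg : fin_gen R (restr M)) (N_fg : fin_gen R (restr N)).
Hypotheses (BM_proj : projective B M) (AN_proj : projective A N).
Hypotheses (MA_proj : projective A^c (right_mod M))
  (NB_proj : projective B^c (right_mod N)).
Variables (P : resolution X) (Q : resolution Y).

Local Notation MP := (tens_resolution P (fin_gen_right M_fg) MA_proj BM_proj).
Local Notation NQ := (tens_resolution Q (fin_gen_right N_fg) NB_proj AN_proj).

Variables (g : forall n, {linear rmod NQ n -> rmod P n})
  (f : forall n, {linear rmod MP n -> rmod Q n}).
Hypotheses (gd : forall n t, rd P n (g n.+1 t) = g n (rd NQ n t))
  (fd : forall n t, rd Q n (f n.+1 t) = f n (rd MP n t)).
Hypotheses (g_extend : forall n (U : lmodType A) (w : {linear rmod NQ n -> U}),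
    exists u : {linear rmod P n -> U}, forall t, u (g n t) = w t)
  (f_extend : forall n (U : lmodType B) (w : {linear rmod MP n -> U}),
    exists u : {linear rmod Q n -> U}, forall t, u (f n t) = w t).

(* Morphisms from (P_i, Q_i) to the first column (A, M) of the Morita ring. *)
Definition column_cochain i (u : {linear rmod P i -> A^o})
    (v : {linear rmod Q i -> M}) : Prop :=
  (forall t, u (g i t) = 0) /\ (forall m x, v (f i (tens m x)) = ract m (u x)).

(** Vanishing of the cohomology of column cochains in degree i + 1. *)
Definition column_acyclic i : Prop :=
  forall u v, column_cochain (i := i.+1) u v -> is_cocycle u -> is_cocycle v ->
  exists u' v', [/\ column_cochain (i := i) u' v', forall x, u x = u' (rd P i x) &
                    forall y, v y = v' (rd Q i y)].

(** This is M (x) u, with M (x) A identified with M. *)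
Let tens_act i (u : {linear rmod P i -> A^o}) :
  {w : {linear rmod MP i -> M} | forall m x, w (tens m x) = ract m (u x)}.
Proof.
apply: balanced_lift; split=> [x m m'|m x x'|m a x|b m x].
- exact: ractDl.
- by rewrite raddfD ractDr.
- by rewrite ractA linearZ_LR.
- exact: ractZ.
Qed.

Let tens_act_cocycle i u : is_cocycle u -> is_cocycle (P := MP) (sval (@tens_act i u)).
Proof.
move=> u0; apply: (tensor_linear_ext (h := sval (tens_act u) \o tens_map M (rd P i))
  (k := \0)) => m x /=.
by rewrite tens_mapE (svalP (tens_act u)) u0 ract0r.
Qed.

Lemma column_act i (u : {linear rmod P i -> A^o}) :
  exists v : {linear rmod Q i -> M}, forall m x, v (f i (tens m x)) = ract m (u x).
Proof.
have [v vE] := f_extend (sval (tens_act u)); exists v => m x.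
by rewrite vE (svalP (tens_act u)).
Qed.

Lemma column_cocycle_extend i : column_acyclic i -> cocycle_extend g A^o i.
Proof.
move=> acyc w w0; have [u uE] := g_extend w; have [v vE] := column_act u.
(* The coboundaries of u and v form a column cochain: on N (x) Q the first one restricts to the
   coboundary of w, which is zero. *)
have [|x|y|u' [v' [[u'g _] u'E _]]] := acyc (u \o rd P i) (v \o rd Q i).
- by split=> [t|m x] /=; rewrite ?gd ?uE ?w0 // fd /= tens_mapE vE.
- by rewrite /= rdK raddf0.
- by rewrite /= rdK raddf0.
by exists (u \- u') => x /=; rewrite ?u'g ?subr0 // -u'E subrr.
Qed.

Lemma column_coh_inj i :
  column_acyclic i -> cocycle_extend f M i.+1 -> coh_inj g A^o i.+1.
Proof.
move=> acyc ext u u0 [/= b bE]; have [b' b'E] := g_extend b.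
(* Subtracting the coboundary of an extension of b keeps the class of u and makes it vanish on the
   image of [g]. *)
pose u1 : {linear rmod P i.+1 -> A^o} := u \- (b' \o rd P i).
have u1g t : u1 (g i.+1 t) = 0 by rewrite /= gd b'E -bE subrr.
have u1_cocycle : is_cocycle u1 by move=> x; rewrite /= u0 rdK raddf0 subr0.
have [v v0 vE] := ext _ (tens_act_cocycle u1_cocycle).
have [|u' [v' [_ u'E _]]] := acyc u1 v _ u1_cocycle v0.
  by split=> // m x; rewrite vE (svalP (tens_act u1)).
by exists (u' \+ b') => x /=; rewrite -u'E /= subrK.
Qed.

Lemma kernel_acyclic_column i :
  kernel_acyclic g A^o i -> kernel_acyclic f M i -> column_acyclic i.
Proof.
move=> g_acyc f_acyc u v [ug vf] u0 v0.
have [b bE bg] := g_acyc u u0 ug; have [c cE] := column_act b.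
(* Here (b, c) is a column cochain with the right first coboundary. The error v - c d kills the
   image of [f], so it is the coboundary of some c' that also kills it, and c + c' replaces c. *)
have [y|t|c' c'E c'f] := f_acyc (v \- (c \o rd Q i)).
- by rewrite /= v0 rdK raddf0 subr0.
- apply: (tensor_linear_ext (h := (v \- (c \o rd Q i)) \o f i.+1) (k := \0)) => m x /=.
  by rewrite vf fd /= tens_mapE cE bE subrr.
exists b, (c \+ c'); split=> // [|y]; last by rewrite /= -c'E addrC subrK.
by split=> // m x /=; rewrite cE c'f addr0.
Qed.

End Columns.

(** * Corners of a resolution *)

Section CornerResolution.
Context {S A : nzRingType} (iota : corner_map (S := S) (A := A)).
Hypothesis eS_proj : projective A (corner iota S^o).
Variables (Z : lmodType S) (C : resolution Z) (X : lmodType A).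
Variable k : {linear corner iota Z -> X}.
Hypotheses (k_surj : surjective k) (k_inj : forall z, k z = 0 -> z = 0).

Fact corner_aug_surj : surjective (k \o corner_fun iota (raug C)).
Proof.
move=> x; have [z <-] := k_surj x.
by have [c <-] := corner_surj (iota := iota) (raug_surj C) z; exists c.
Qed.

Fact corner_aug_exact c : (k \o corner_fun iota (raug C)) c = 0 <->
  exists c', c = corner_fun iota (rd C 0) c'.
Proof.
rewrite -(corner_exact (iota := iota) (raug_exact C)).
by split=> /= [/k_inj|->]; rewrite ?raddf0.
Qed.

(** The isomorphism [k] from e Z to X enters through the augmentation, so that X itself is
    resolved. *)
Definition corner_resolution : resolution X := {|
  rmod := fun n => corner iota (rmod C n);
  rd := fun n => corner_fun iota (rd C n);
  raug := k \o corner_fun iota (raug C);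
  rmod_proj := fun n => corner_projective eS_proj (rmod_proj C n);
  raug_surj := corner_aug_surj;
  raug_exact := corner_aug_exact;
  rd_exact := fun n => corner_exact (iota := iota) (rd_exact C n) |}.

End CornerResolution.

(** * Morphisms into the Morita ring, column by column *)

Section MoritaColumns.
Context {R : comNzRingType} {A B : algType R}.
Context {M : bimodType B A} {N : bimodType A B}.
Local Notation L := (morita M N).
Local Notation p := (morita_peirce M N).
Local Notation e1 := (corner_proj (emb11 p)).
Local Notation e2 := (corner_proj (emb22 p)).
Variable F : lmodType L.

Lemma corner1_scale l (z : F) : e1 (l *: z) =
  l.1.1 *: e1 z + peirce_map p F (tens l.1.2 (e2 z)).
Proof. exact: (peirce_row2 (peirce_swap p)). Qed.

Lemma corner2_scale l (z : F) : e2 (l *: z) =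
  l.2.2 *: e2 z + peirce_map (peirce_swap p) F (tens l.2.1 (e1 z)).
Proof. exact: (peirce_row2 p). Qed.

(** As a left module over itself the Morita ring is the sum of its columns (A, M) and (N, B); the
    four conditions say that each pair of maps respects the structure maps of its column. *)
Lemma columns_morphism (u : {linear corner (emb11 p) F -> A^o})
    (v : {linear corner (emb22 p) F -> M}) (u' : {linear corner (emb22 p) F -> B^o})
    (v' : {linear corner (emb11 p) F -> N}) :
  (forall t, u (peirce_map p F t) = 0) ->
  (forall m x, v (peirce_map (peirce_swap p) F (tens m x)) = ract m (u x)) ->
  (forall t, u' (peirce_map (peirce_swap p) F t) = 0) ->
  (forall n y, v' (peirce_map p F (tens n y)) = ract n (u' y)) ->
  exists c : {linear F -> L^o},
    forall z, c z = ((u (e1 z), v' (e1 z)), (v (e2 z), u' (e2 z))) :> L.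
Proof.
move=> ug vf u'f v'g.
have c_lin : linear (fun z => ((u (e1 z), v' (e1 z)), (v (e2 z), u' (e2 z))) : L^o).
  have e1D z w : e1 (z + w) = e1 z + e1 w by apply: val_inj; rewrite /= scalerDr.
  have e2D z w : e2 (z + w) = e2 z + e2 w by apply: val_inj; rewrite /= scalerDr.
  move=> [[a n] [m b]] z w; rewrite e1D e2D corner1_scale corner2_scale !raddfD /=.
  rewrite ug vf u'f v'g !linearZ_LR !addr0.
  by rewrite [b *: _ + ract _ _]addrC.
by exists (linmap c_lin).
Qed.

Section Components.
Variable c : {linear F -> L^o}.

Let comp11 (x : corner (emb11 p) F) : A^o := (c (val x) : L).1.1.
Let comp12 (x : corner (emb11 p) F) : N := (c (val x) : L).1.2.
Let comp21 (y : corner (emb22 p) F) : M := (c (val y) : L).2.1.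
Let comp22 (y : corner (emb22 p) F) : B^o := (c (val y) : L).2.2.

Let cZ (l : L) z : c (l *: z) = l * (c z : L) :> L.
Proof. exact: linearZ_LR. Qed.

Let c1P (a : A) (x x' : corner (emb11 p) F) :
  c (val (a *: x + x')) = emb11 p a * (c (val x) : L) + (c (val x') : L) :> L.
Proof. by rewrite -cZ; apply: (raddfD c). Qed.

Let c2P (b : B) (y y' : corner (emb22 p) F) :
  c (val (b *: y + y')) = emb22 p b * (c (val y) : L) + (c (val y') : L) :> L.
Proof. by rewrite -cZ; apply: (raddfD c). Qed.

Lemma morphism_columns : exists (u : {linear corner (emb11 p) F -> A^o})
    (v : {linear corner (emb22 p) F -> M}) (u' : {linear corner (emb22 p) F -> B^o})
    (v' : {linear corner (emb11 p) F -> N}),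
  [/\ forall z, c z = ((u (e1 z), v' (e1 z)), (v (e2 z), u' (e2 z))) :> L,
      (forall t, u (peirce_map p F t) = 0) /\
      (forall m x, v (peirce_map (peirce_swap p) F (tens m x)) = ract m (u x)) &
      (forall t, u' (peirce_map (peirce_swap p) F t) = 0) /\
      (forall n y, v' (peirce_map p F (tens n y)) = ract n (u' y)) ].
Proof.
have l11 : linear comp11.
  by move=> a x y; rewrite /comp11 c1P; apply: (congr2 +%R (coef11M p a _) erefl).
have l12 : linear comp12.
  by move=> a x y; rewrite /comp12 c1P; apply: (congr2 +%R (coef12M p a _) erefl).
have l21 : linear comp21.
  by move=> b x y; rewrite /comp21 c2P; apply: (congr2 +%R (coef21M p b _) erefl).
have l22 : linear comp22.
  by move=> b x y; rewrite /comp22 c2P; apply: (congr2 +%R (coef22M p b _) erefl).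
have map1E n y : c (val (peirce_map p F (tens n y))) = emb12 p n * (c (val y) : L) :> L.
  by rewrite peirce_mapE cZ.
have map2E m x : c (val (peirce_map (peirce_swap p) F (tens m x))) =
    emb21 p m * (c (val x) : L) :> L.
  by rewrite -cZ; congr (c _); apply: peirce_mapE.
exists (linmap l11), (linmap l21), (linmap l22), (linmap l12); split=> [z||].
- rewrite /= /comp11 /comp12 /comp21 /comp22 !cZ (row1E p) (row2E p).
  by case: (c z) => -[a n] [m b] /=; rewrite !addr0 !add0r.
- split=> [|m x] /=; last by rewrite /comp21 map2E; apply: (coef21_row p).
  (* The product of n with the M-entry of a matrix contributes nothing to the upper left entry,
     because the map N (x) M -> A of this Morita ring is zero. *)
  apply: (tensor_linear_ext (h := linmap l11 \o peirce_map p F) (k := \0)) => n y /=.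
  by rewrite /comp11 map1E; case: (c (val y)) => -[a n'] [m b] /=; apply: mul0r.
- split=> [|n y] /=; last by rewrite /comp12 map1E; apply: (coef12_row p).
  apply: (tensor_linear_ext (h := linmap l22 \o peirce_map (peirce_swap p) F)
    (k := \0)).
  move=> m x /=.
  by rewrite /comp22 map2E; case: (c (val x)) => -[a n] [m' b] /=; apply: mul0r.
Qed.

End Components.
End MoritaColumns.


Lemma corner_proj_fun (S T : nzRingType) (iota : corner_map (S := S) (A := T))
    (G H : lmodType S) (d : {linear G -> H}) z :
  corner_proj iota (d z) = corner_fun iota d (corner_proj iota z).
Proof. by apply: val_inj; rewrite /= linearZ_LR. Qed.

(* Cochains with values in the first column of S; the second column is obtained
   from [peirce_swap p]. *)
Definition column_exact (S : nzRingType) (R : comNzRingType) (A B : algType R)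
    (M : bimodType B A) (N : bimodType A B) (p : peirce S M N) (F2 F1 F0 : lmodType S)
    (d2 : {linear F2 -> F1}) (d1 : {linear F1 -> F0}) : Prop :=
  forall (u : {linear corner (emb11 p) F1 -> A^o})
    (v : {linear corner (emb22 p) F1 -> M}),
  (forall t, u (peirce_map p F1 t) = 0) /\
  (forall m x, v (peirce_map (peirce_swap p) F1 (tens m x)) = ract m (u x)) ->
  (forall x, u (corner_fun (emb11 p) d2 x) = 0) ->
  (forall y, v (corner_fun (emb22 p) d2 y) = 0) ->
  exists (u' : {linear corner (emb11 p) F0 -> A^o})
    (v' : {linear corner (emb22 p) F0 -> M}),
  [/\ (forall t, u' (peirce_map p F0 t) = 0) /\
      (forall m x, v' (peirce_map (peirce_swap p) F0 (tens m x)) = ract m (u' x)),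
      forall x, u x = u' (corner_fun (emb11 p) d1 x) &
      forall y, v y = v' (corner_fun (emb22 p) d1 y)].


Section ColumnCohomology.
Context {R : comNzRingType} {A B : algType R}.
Context {M : bimodType B A} {N : bimodType A B}.
Local Notation L := (morita M N).
Local Notation p := (morita_peirce M N).
Variables (F2 F1 F0 : lmodType L) (d2 : {linear F2 -> F1}) (d1 : {linear F1 -> F0}).

Lemma columns_exact :
  (forall c : {linear F1 -> L^o}, (forall z, c (d2 z) = 0) ->
     exists b : {linear F0 -> L^o}, forall z, c z = b (d1 z)) <->
  column_exact p d2 d1 /\ column_exact (peirce_swap p) d2 d1.
Proof.
split=> [coh|[exact1 exact2] c c0].
  split=> u v [ug vf] u0 v0.
    (* A single column is completed by the zero column, and the resulting cobounding morphism is
       projected back. *)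
    have [||c cE] := columns_morphism (u := u) (v := v) (u' := \0) (v' := \0) ug vf.
    - by [].
    - by move=> n y; rewrite ract0r.
    have [z|b bE] := coh c; first by rewrite cE !corner_proj_fun u0 v0.
    have [u1 [v1 [u2 [v2 [bcE col1 col2]]]]] := morphism_columns b.
    have cbE z := etrans (esym (cE z)) (etrans (bE z) (bcE _)).
    exists u1, v1; split=> // [x|y].
      have := congr1 (fun l : L => l.1.1) (cbE (val x)).
      by rewrite /= corner_proj_fun corner_projK.
    have := congr1 (fun l : L => l.2.1) (cbE (val y)).
    by rewrite /= corner_proj_fun corner_projK.
  have [||c cE] := columns_morphism (u := \0) (v := \0) (u' := u) (v' := v) _ _ ug vf.
  - by [].
  - by move=> n y; rewrite ract0r.
  have [z|b bE] := coh c; first by rewrite cE !corner_proj_fun u0 v0.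
  have [u2 [v2 [u1 [v1 [bcE col2 col1]]]]] := morphism_columns b.
  have cbE z := etrans (esym (cE z)) (etrans (bE z) (bcE _)).
  exists u1, v1; split=> // [y|x].
    have := congr1 (fun l : L => l.2.2) (cbE (val y)).
    by rewrite /= corner_proj_fun corner_projK.
  have := congr1 (fun l : L => l.1.2) (cbE (val x)).
  by rewrite /= corner_proj_fun corner_projK.
have [u [v [u' [v' [cE col1 col2]]]]] := morphism_columns c.
have c0E z := etrans (esym (cE (d2 z))) (c0 z).
have [||u1 [v1 [[u1g v1f] uE vE]]] := exact1 u v col1.
- move=> x; have := congr1 (fun l : L => l.1.1) (c0E (val x)).
  by rewrite /= corner_proj_fun corner_projK.
- move=> y; have := congr1 (fun l : L => l.2.1) (c0E (val y)).
  by rewrite /= corner_proj_fun corner_projK.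
have [||u2 [v2 [[u2f v2g] u'E v'E]]] := exact2 u' v' col2.
- move=> y; have := congr1 (fun l : L => l.2.2) (c0E (val y)).
  by rewrite /= corner_proj_fun corner_projK.
- move=> x; have := congr1 (fun l : L => l.1.2) (c0E (val x)).
  by rewrite /= corner_proj_fun corner_projK.
have [b bE] := columns_morphism u1g v1f u2f v2g.
by exists b => z; rewrite cE bE !corner_proj_fun uE vE u'E v'E.
Qed.

End ColumnCohomology.

(** * The resolutions of X and Y cut out of that of Z, and the equivalence *)

Section SemiGorensteinProjective.
Context {R : comNzRingType} {A B : algType R}.
Variables (M : bimodType B A) (N : bimodType A B).
Hypotheses (M_fg : fin_gen R (restr M)) (N_fg : fin_gen R (restr N)).
Variables (MN0 : forall t : tensor M N, t = 0) (NM0 : forall t : tensor N M, t = 0).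
Hypotheses (BM_proj : projective B M) (AN_proj : projective A N).
Hypotheses (MA_proj : projective A^c (right_mod M))
  (NB_proj : projective B^c (right_mod N)).
Variables (X : lmodType A) (Y : lmodType B).
Variables (f : {linear tensor M X -> Y}) (g : {linear tensor N Y -> X}).

Local Notation L := (morita M N).
Local Notation p := (morita_peirce M N).
Local Notation Z := (morita_mod MN0 NM0 f g : lmodType L).

Let scaleE (l : L) (z : Z) : l *: z =
  (l.1.1 *: (z : X * Y).1 + g (tens l.1.2 (z : X * Y).2),
   f (tens l.2.1 (z : X * Y).1) + l.2.2 *: (z : X * Y).2) :> X * Y.
Proof. by case: l z => -[a n] [m b] [x y]. Qed.

Let k1_subproof :
  {k : {linear corner (emb11 p) Z -> X} | forall z, k z = (val z : X * Y).1}.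
Proof.
have k_lin : linear (fun z : corner (emb11 p) Z => (val z : X * Y).1).
  move=> a z w; transitivity ((emb11 p a *: val z : X * Y).1 + (val w : X * Y).1) => //.
  by rewrite scaleE /= tens0l raddf0 addr0.
by exists (linmap k_lin).
Qed.

Let k2_subproof :
  {k : {linear corner (emb22 p) Z -> Y} | forall z, k z = (val z : X * Y).2}.
Proof.
have k_lin : linear (fun z : corner (emb22 p) Z => (val z : X * Y).2).
  move=> b z w; transitivity ((emb22 p b *: val z : X * Y).2 + (val w : X * Y).2) => //.
  by rewrite scaleE /= tens0l raddf0 add0r.
by exists (linmap k_lin).
Qed.

Let k1 := sval k1_subproof.
Let k1E : forall z, k1 z = (val z : X * Y).1 := svalP k1_subproof.
Let k2 := sval k2_subproof.
Let k2E : forall z, k2 z = (val z : X * Y).2 := svalP k2_subproof.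

Let k1_surj : surjective k1.
Proof.
move=> x; exists (corner_proj (emb11 p) ((x, 0) : Z)).
by rewrite k1E [val _]scaleE /= tens0l raddf0 addr0 scale1r.
Qed.

Let k2_surj : surjective k2.
Proof.
move=> y; exists (corner_proj (emb22 p) ((0, y) : Z)).
by rewrite k2E [val _]scaleE /= tens0l raddf0 add0r scale1r.
Qed.

Let k1_inj z : k1 z = 0 -> z = 0.
Proof.
rewrite k1E => z0; apply: val_inj; rewrite -corner_valP [LHS]scaleE z0 /=.
by rewrite !tens0l !raddf0 scale0r !addr0.
Qed.

Let k2_inj z : k2 z = 0 -> z = 0.
Proof.
rewrite k2E => z0; apply: val_inj; rewrite -corner_valP [LHS]scaleE z0 /=.
by rewrite !tens0l !raddf0 scale0r !addr0.
Qed.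

Let C := free_resolution Z.
Let P : resolution X :=
  corner_resolution (corner1_projective (p := p) AN_proj) C k1_surj k1_inj.
Let Q : resolution Y :=
  corner_resolution (corner1_projective (p := peirce_swap p) BM_proj) C k2_surj k2_inj.
Let NQ := tens_resolution Q (fin_gen_right N_fg) NB_proj AN_proj.
Let MP := tens_resolution P (fin_gen_right M_fg) MA_proj BM_proj.
Let gC n : {linear rmod NQ n -> rmod P n} := peirce_map p (rmod C n).
Let fC n : {linear rmod MP n -> rmod Q n} := peirce_map (peirce_swap p) (rmod C n).

(** Commutation with the differentials is naturality of the structure map. For the augmentations,
    the first component of a matrix with single entry n acting on Z is g (n (x) y). *)
Let gC_lifts : lifts g gC.
Proof.
split=> [|n t]; last exact: (@peirce_map_natural _ _ _ _ _ _ p _ _ (rd C n) t).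
apply: (tensor_linear_ext (h := raug P \o gC 0) (k := g \o tens_map N (raug Q))) => n y.
rewrite [LHS]k1E -[val _]/(raug C (val (peirce_map p (rmod C 0) (tens n y)))).
rewrite peirce_mapE linearZ_LR scaleE /= tens_mapE scale0r add0r.
by congr (g (tens n _)); rewrite [RHS]k2E.
Qed.

Let fC_lifts : lifts f fC.
Proof.
split=> [|n t].
  2: exact: (@peirce_map_natural _ _ _ _ _ _ (peirce_swap p) _ _ (rd C n) t).
apply: (tensor_linear_ext (h := raug Q \o fC 0) (k := f \o tens_map M (raug P))) => m x.
rewrite [LHS]k2E.
rewrite -[val _]/(raug C (val (peirce_map (peirce_swap p) (rmod C 0) (tens m x)))).
rewrite peirce_mapE linearZ_LR scaleE /= tens_mapE scale0r addr0.
by congr (f (tens m _)); rewrite [RHS]k1E.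
Qed.

Let gC_extend n (U : lmodType A) (w : {linear rmod NQ n -> U}) :
  exists u : {linear rmod P n -> U}, forall t, u (gC n t) = w t.
Proof. exact: (peirce_map_extend (p := p) NM0 (K := syz n Z) w). Qed.

Let fC_extend n (U : lmodType B) (w : {linear rmod MP n -> U}) :
  exists u : {linear rmod Q n -> U}, forall t, u (fC n t) = w t.
Proof. exact: (peirce_map_extend (p := peirce_swap p) MN0 (K := syz n Z) w). Qed.

Lemma semi_Gorenstein_projective_columns : semi_Gorenstein_projective Z <->
  forall i, column_acyclic gC fC i /\ column_acyclic fC gC i.
Proof.
have colsE i : (forall e : Ext i.+1 Z L^o, e = 0) <->
    column_acyclic gC fC i /\ column_acyclic fC gC i.
  apply: iff_trans (Ext_eq0 i.+1 Z L^o) _.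
  (* For these corner resolutions [column_exact] and [column_acyclic] are convertible. *)
  exact: (columns_exact (rd C i.+1) (rd C i)).
by split=> [Z_sGP i|acyc [//|i] _]; apply/colsE; [apply: Z_sGP | apply: acyc].
Qed.

Lemma columns_conditions :
  (forall i, column_acyclic gC fC i /\ column_acyclic fC gC i) <->
  ((forall i, cocycle_extend gC A^o i) /\ (forall i, coh_inj gC A^o i.+1)) /\
  ((forall i, cocycle_extend fC B^o i) /\ (forall i, coh_inj fC B^o i.+1)).
Proof.
have [gd fd] := (gC_lifts.2, fC_lifts.2).
split=> [acyc|[[g_ext g_inj] [f_ext f_inj]] i].
  (* Both extension properties come first: injectivity for [g] uses extension along [f] with
     coefficients in M, and injectivity for [f] uses extension along [g] with coefficients in N. *)
  have g_ext i := column_cocycle_extend gd fd gC_extend fC_extend (acyc i).1.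
  have f_ext i := column_cocycle_extend fd gd fC_extend gC_extend (acyc i).2.
  split; split=> // i.
    apply: (column_coh_inj gd gC_extend (acyc i).1).
    exact: cocycle_extend_projective (fin_gen_left M_fg) BM_proj (f_ext _).
  apply: (column_coh_inj fd fC_extend (acyc i).2).
  exact: cocycle_extend_projective (fin_gen_left N_fg) AN_proj (g_ext _).
have g_acyc := kernel_acyclicP gd (g_ext i) (g_inj i).
have f_acyc := kernel_acyclicP fd (f_ext i) (f_inj i).
split.
  apply: (kernel_acyclic_column fd fC_extend g_acyc).
  exact: kernel_acyclic_projective (fin_gen_left M_fg) BM_proj f_acyc.
apply: (kernel_acyclic_column gd gC_extend f_acyc).
exact: kernel_acyclic_projective (fin_gen_left N_fg) AN_proj g_acyc.
Qed.

Lemma semi_Gorenstein_projective_conditions : semi_Gorenstein_projective Z <->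
  (surjective (Hom_map g A^o) /\
   forall i, (1 <= i)%N -> bijective (Ext_map i g A^o)) /\
  (surjective (Hom_map f B^o) /\
   forall i, (1 <= i)%N -> bijective (Ext_map i f B^o)).
Proof.
have g_cond := Ext_map_conditions A^o gC_lifts gC_extend.
have f_cond := Ext_map_conditions B^o fC_lifts fC_extend.
apply: (iff_trans semi_Gorenstein_projective_columns).
apply: (iff_trans columns_conditions).
by split=> -[/g_cond ? /f_cond ?].
Qed.

End SemiGorensteinProjective.

Theorem theorem1p3 (R : comNzRingType) (A B : algType R)
    (M : bimodType B A) (N : bimodType A B)
    (A_artin : artin_algebra A) (B_artin : artin_algebra B)
    (M_fg : fin_gen R (restr M)) (N_fg : fin_gen R (restr N))
    (Lambda_artin : artin_algebra (morita M N))
    (MN0 : forall t : tensor M N, t = 0)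
    (NM0 : forall t : tensor N M, t = 0)
    (BM_proj : projective B M) (AN_proj : projective A N)
    (MA_proj : projective A^c (right_mod M))
    (NB_proj : projective B^c (right_mod N))
    (X : lmodType A) (Y : lmodType B)
    (X_fg : fin_gen A X) (Y_fg : fin_gen B Y)
    (f : {linear tensor M X -> Y}) (g : {linear tensor N Y -> X}) :
  semi_Gorenstein_projective
    (morita_mod MN0 NM0 f g : lmodType (morita M N)) <->
  [/\ surjective (Hom_map g A^o),
      forall i, (1 <= i)%N -> bijective (Ext_map i g A^o),
      surjective (Hom_map f B^o) &
      forall i, (1 <= i)%N -> bijective (Ext_map i f B^o)].
Proof.
apply: iff_trans (semi_Gorenstein_projective_conditions M_fg N_fg MN0 NM0
  BM_proj AN_proj MA_proj NB_proj f g) _.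
by split=> [[[? ?] [? ?]]|[]].
Qed.
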